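(* For every integer $n\ge 1$, the symmetric topological complexity of the complex projective space $\mathbb{C}\mathrm{P}^n$ (of complex dimension $n$) is $\mathrm{TC}^S(\mathbb{C}\mathrm{P}^n)=2n+1$.
   Context: The Schwarz genus $\mathrm{genus}(p)$ of a fibration $p\colon E\to B$ is the smallest number of open sets $U$ covering $B$ such that $p$ admits a continuous section over each $U$. For a topological space $X$, let $P(X)=X^{[0,1]}$ be the free path space with the compact-open topology, and $\mathrm{ev}\colon P(X)\to X\times X$, $\gamma\mapsto(\gamma(0),\gamma(1))$. Let $\Delta_X\subset X\times X$ be the diagonal, and let $\mathrm{ev}_1\colon P_1(X)\to X\times X-\Delta_X$ be the restriction of $\mathrm{ev}$, so $P_1(X)$ is the subspace of paths $\gamma$ with $\gamma(0)\neq\gamma(1)$. The group $\mathbb{Z}/2$ acts freely on $P_1(X)$ by running paths backwards and on $X\times X-\Delta_X$ by switching coordinates, and $\mathrm{ev}_1$ is equivariant. Let $P_2(X)$ and $B(X,2)$ be the orbit spaces and $\mathrm{ev}_2\colon P_2(X)\to B(X,2)$ the induced fibration. The symmetric topological complexity of $X$ is $\mathrm{TC}^S(X)=\mathrm{genus}(\mathrm{ev}_2)+1$. *)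

(* Defs.v *)
From HB Require Import structures.
From mathcomp Require Import all_boot all_order all_algebra.
From mathcomp Require Import generic_quotient.
From mathcomp Require Import all_classical all_reals all_analysis.
From mathcomp Require Import complex.

Set Implicit Arguments.
Unset Strict Implicit.
Unset Printing Implicit Defensive.
Import Order.TTheory GRing.Theory Num.Theory.
Import numFieldNormedType.Exports.
Local Open Scope classical_set_scope.
Local Open Scope ring_scope.
Local Open Scope complex_scope.
Local Open Scope quotient_scope.

Section schwarz_genus.
Context {E B : topologicalType} (p : E -> B).

Definition has_section (U : set B) : Prop :=
  exists s : U -> E, continuous s /\ forall b : U, p (s b) = set_val b.

Definition section_cover (k : nat) : Prop :=
  exists U : 'I_k -> set B,
    [/\ forall i, open (U i), \bigcup_i U i = setT & forall i, has_section (U i)].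

(* [None] stands for an infinite genus *)
Definition genus : option nat :=
  if pselect (exists k, `[< section_cover k >]) is left h
  then Some (ex_minn h) else None.

End schwarz_genus.

(* Orbit space of the action of Z/2 generated by an involution *)
Section orbit_space.
Context {T : topologicalType} (s : T -> T) (sK : involutive s).

Definition same_orbit (x y : T) : bool := (x == y) || (x == s y).

Lemma same_orbit_refl : reflexive same_orbit.
Proof. by move=> x; rewrite /same_orbit eqxx. Qed.

Lemma same_orbit_sym : symmetric same_orbit.
Proof.
by move=> x y; rewrite /same_orbit eq_sym -(inv_eq sK) [s x == y]eq_sym.
Qed.

Lemma same_orbit_trans : transitive same_orbit.
Proof.
move=> y x z /orP[] /eqP -> /orP[] /eqP ->;
  by rewrite /same_orbit ?sK eqxx ?orbT.
Qed.

Definition orbit_equiv :=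
  EquivRel same_orbit same_orbit_refl same_orbit_sym same_orbit_trans.

Definition orbit_space : topologicalType :=
  quotient_topology {eq_quot orbit_equiv}.

Definition orbit_of (x : T) : orbit_space := \pi_{eq_quot orbit_equiv} x.

Definition orbit_repr (q : orbit_space) : T := repr (q : {eq_quot orbit_equiv}).

Lemma orbit_reprK : cancel orbit_repr orbit_of.
Proof. by move=> q; rewrite /orbit_of /orbit_repr reprK. Qed.

Lemma orbit_ofP (x y : T) : orbit_of x = orbit_of y <-> x = y \/ x = s y.
Proof.
split => [/(@eqquotP _ orbit_equiv {eq_quot orbit_equiv})/orP[]/eqP|xy]; [by left|by right|].
by apply/(@eqquotP _ orbit_equiv {eq_quot orbit_equiv})/orP; case: xy => ->; [left|right].
Qed.

End orbit_space.

Section configuration_space.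
Context (X : topologicalType).

Definition off_diagonal : set (X * X) := [set xy | xy.1 <> xy.2].

Lemma switch_subproof (z : off_diagonal) :
  ((set_val z).2, (set_val z).1) \in off_diagonal.
Proof.
by apply/mem_set => /= /esym; have := set_valP z; rewrite /off_diagonal.
Qed.

Definition switch (z : off_diagonal) : off_diagonal :=
  exist (fun x => x \in off_diagonal) _ (switch_subproof z).

Lemma switchK : involutive switch.
Proof. by move=> z; apply/val_inj; case: z => -[]. Qed.

(* B(X, 2) *)
Definition unordered_pairs : topologicalType := orbit_space switchK.

End configuration_space.
Arguments off_diagonal : clear implicits.

Section path_spaces.
Context (R : realType) (X : topologicalType).

Definition unit_interval : set R := `[0, 1].

Lemma unit_interval0_subproof : (0 : R) \in unit_interval.
Proof. by apply/mem_set; rewrite /unit_interval /= in_itv /= lexx ler01. Qed.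

Lemma unit_interval1_subproof : (1 : R) \in unit_interval.
Proof. by apply/mem_set; rewrite /unit_interval /= in_itv /= lexx ler01. Qed.

Definition I0 : unit_interval :=
  exist (fun x => x \in unit_interval) _ unit_interval0_subproof.
Definition I1 : unit_interval :=
  exist (fun x => x \in unit_interval) _ unit_interval1_subproof.

Lemma backwards_subproof (t : unit_interval) : 1 - set_val t \in unit_interval.
Proof.
have := set_valP t; rewrite /unit_interval /= in_itv /= => /andP[t0 t1].
by apply/mem_set; rewrite /= in_itv /= subr_ge0 t1 gerBl.
Qed.

Definition backwards (t : unit_interval) : unit_interval :=
  exist (fun x => x \in unit_interval) _ (backwards_subproof t).

Lemma backwardsK : involutive backwards.
Proof. by move=> t; apply/val_inj; rewrite /= opprB addrCA subrr addr0. Qed.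

Lemma backwards0 : backwards I0 = I1.
Proof. by apply/val_inj; rewrite /= subr0. Qed.

Lemma backwards1 : backwards I1 = I0.
Proof. by apply/val_inj; rewrite /= subrr. Qed.

Lemma backwards_continuous : continuous backwards.
Proof.
apply/continuousP => A [V oV <-].
exists ((fun r : R => 1 - r) @^-1` V) => //.
have h : continuous (fun r : R => 1 - r).
  by move=> r; apply: (@cvgB _ R^o); [exact: cvg_cst|exact: cvg_id].
by move/continuousP : h; exact.
Qed.

HB.instance Definition _ :=
  @isContinuous.Build unit_interval unit_interval backwards backwards_continuous.

Definition free_path : Type := continuousType unit_interval X.

HB.instance Definition _ := Choice.on free_path.
HB.instance Definition _ := Topological.copy free_path
  (@initial_topology free_path {compact-open, unit_interval -> X}
     (fun g : free_path => g : unit_interval -> X)).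

Definition ev (g : free_path) : X * X := (g I0, g I1).

Definition reverse_path (g : free_path) : free_path :=
  (g : continuousType unit_interval X) \o backwards.

Lemma reverse_pathK : involutive reverse_path.
Proof. by move=> g; apply/continuousEP => t /=; rewrite backwardsK. Qed.

Lemma ev_reverse_path (g : free_path) :
  ev (reverse_path g) = ((ev g).2, (ev g).1).
Proof. by rewrite /ev /= backwards0 backwards1. Qed.

(* P_1(X) *)
Definition nonloop : set free_path := ev @^-1` off_diagonal X.

Lemma ev1_subproof (g : nonloop) : ev (set_val g) \in off_diagonal X.
Proof. by apply/mem_set; exact: (set_valP g). Qed.

Definition ev1 (g : nonloop) : off_diagonal X :=
  exist (fun x => x \in off_diagonal X) _ (ev1_subproof g).

Lemma reverse_nonloop_subproof (g : nonloop) :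
  reverse_path (set_val g) \in nonloop.
Proof.
apply/mem_set; rewrite /nonloop /= ev_reverse_path.
by move=> /= /esym; exact: (set_valP g).
Qed.

Definition reverse_nonloop (g : nonloop) : nonloop :=
  exist (fun x => x \in nonloop) _ (reverse_nonloop_subproof g).

Lemma reverse_nonloopK : involutive reverse_nonloop.
Proof. by move=> g; apply/val_inj => /=; rewrite reverse_pathK. Qed.

Lemma ev1_equivariant (g : nonloop) : ev1 (reverse_nonloop g) = switch (ev1 g).
Proof. by apply/val_inj; rewrite /= ev_reverse_path. Qed.

(* P_2(X) *)
Definition unordered_paths : topologicalType := orbit_space reverse_nonloopK.

Definition ev2 (q : unordered_paths) : unordered_pairs X :=
  orbit_of (@switchK X) (ev1 (orbit_repr q)).

Lemma ev2E (g : nonloop) :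
  ev2 (orbit_of reverse_nonloopK g) = orbit_of (@switchK X) (ev1 g).
Proof.
apply/orbit_ofP; rewrite -ev1_equivariant.
have /orbit_ofP[->|->] := orbit_reprK (orbit_of reverse_nonloopK g); by [left|right].
Qed.

(* [None] stands for infinity *)
Definition TCS : option nat := omap succn (genus ev2).

End path_spaces.

Section projective_space.
Context (R : realType) (n : nat).

(* the regular module [R[i]^o] carries the topology of the complex norm *)
Definition nonzero_vector : set 'rV[R[i]^o]_n.+1 := [set v | v != 0].

Definition proportional (v w : nonzero_vector) : bool :=
  `[< exists2 a : R[i], a != 0 & set_val v = a *: set_val w >].

Lemma proportional_refl : reflexive proportional.
Proof. by move=> v; apply/asboolP; exists 1; rewrite ?oner_neq0 ?scale1r. Qed.

Lemma proportional_sym : symmetric proportional.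
Proof.
suff h v w : proportional v w -> proportional w v.
  by move=> v w; apply/idP/idP; exact: h.
move=> /asboolP[a a0 vw]; apply/asboolP; exists a^-1; first by rewrite invr_neq0.
by rewrite vw scalerA mulVf// scale1r.
Qed.

Lemma proportional_trans : transitive proportional.
Proof.
move=> w v u /asboolP[a a0 vw] /asboolP[b b0 wu]; apply/asboolP; exists (a * b).
  by rewrite mulf_neq0.
by rewrite vw wu scalerA.
Qed.

Definition proportional_equiv :=
  EquivRel proportional proportional_refl proportional_sym proportional_trans.

Definition CP : topologicalType :=
  quotient_topology {eq_quot proportional_equiv}.

End projective_space.

(* Main.v *)
Require Import Defs.
From mathcomp Require Import all_boot all_order all_algebra.
From mathcomp Require Import generic_quotient.
From mathcomp Require Import all_classical all_reals all_analysis.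
From HB Require Import structures.
From mathcomp Require Import complex ring lra zify.

(* Upper bound. For lines [u] and [v], a nonzero complex number transforming like
   conj(u) v identifies the phases of [u] and [v] and hence selects a path
   joining the two lines. Identify C^(n+1) with polynomials of degree at most n
   and let <u, v> be the sum of conj(u(k)) v(k) over k = 0, ..., n. After a
   symmetric orthogonalization of the pair, the numbers conj(u(k)) v(k),
   k = 1, ..., 2n, cannot all vanish: since <u, v> = 0, otherwise also k = 0
   would be a root of conj(u) v, which has degree at most 2n. They are conjugated
   when the pair is switched, which reverses the path. This gives 2n symmetric
   motion planners.

   Lower bound. Let L be the line bundle Hom(l2, l1) over CP^n x CP^n. A motion
   planner over an open set trivializes L there by holonomy along its paths, and L
   is also trivial near the diagonal. So a cover of B(CP^n, 2) by 2n - 1 open sets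
   with sections would give a cover of CP^n x CP^n by 2n sets trivializing L, hence
   one of the torus T^(4n) mapped to it by (T^2)^n -> (CP^1)^n -> CP^n on each
   factor. On a fine cubical subdivision of the torus, the constant 2-cochain
   representing c_1(L) then differs by a coboundary from a cochain vanishing near
   any given cube, for one of the 2n sets; the cup product of these 2n cochains is
   zero, although it is cohomologous to the nonzero multiple of the top class given
   by the 2n-th cup power of c_1(L). *)
Set Implicit Arguments.
Unset Strict Implicit.
Unset Printing Implicit Defensive.
Import Order.TTheory GRing.Theory Num.Theory.
Import numFieldNormedType.Exports.
Local Open Scope ring_scope.

(** * Cubical cochains on the discrete torus *)

Section discrete_torus.
Variables (R : realFieldType) (m K : nat).

(** The directions [(j, false)] and [(j, true)] are the x-axis and the y-axis of the j-th factor
    T^2. *)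
Definition dir : finType := ('I_m * bool)%type.
Definition grid : finType := {ffun dir -> 'I_K.+1}.

Definition shift (J : {set dir}) (x : grid) : grid :=
  [ffun k => if k \in J then ordS (x k) else x k].

Definition step (k : dir) : grid -> grid := shift [set k].

Lemma step_shift (J : {set dir}) k x : k \notin J ->
  step k (shift J x) = shift (k |: J) x.
Proof.
move=> kJ; apply/ffunP => l; rewrite !ffunE !inE.
by case: eqVneq => [->|//]; rewrite (negbTE kJ).
Qed.

Lemma step_inj k : injective (step k).
Proof.
move=> x y /ffunP xy; apply/ffunP => l; have := xy l; rewrite !ffunE !inE.
by case: eqP => // _; exact: (bij_inj (ordS_bij _)).
Qed.

Lemma stepC k l x : step k (step l x) = step l (step k x).
Proof.
apply/ffunP => j; rewrite !ffunE !inE.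
by case: (j == k); case: (j == l).
Qed.

Definition dir_lt (k l : dir) : bool :=
  (k.1 < l.1)%N || ((k.1 == l.1) && (~~ k.2 && l.2)).

Lemma dir_ltNlt k l : k != l -> dir_lt l k = ~~ dir_lt k l.
Proof.
case: k l => [i b] [j c]; rewrite /dir_lt /= -val_eqE /= xpair_eqE -val_eqE /=.
by rewrite (eq_sym (j : nat)); case: (ltngtP i j) => //= _; case: b c => [] [].
Qed.

Definition wedge_sign (k : dir) (S : {set dir}) : R :=
  (-1) ^+ #|[set s in S | dir_lt s k]|.

Lemma wedge_signD1 k l (S : {set dir}) : l \in S ->
  wedge_sign k S = (-1) ^+ dir_lt l k * wedge_sign k (S :\ l).
Proof.
move=> lS; rewrite /wedge_sign -exprD; congr (_ ^+ _).
rewrite (cardsD1 l) inE lS /=; congr (_ + #|pred_of_set _|)%N.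
by apply/setP => s; rewrite !inE andbA.
Qed.

(** Exactly one of [k] and [l] precedes the other, so the two orders of removal differ by one
    sign. *)
Lemma wedge_sign_swap k l (S : {set dir}) : k \in S -> l \in S -> k != l ->
  wedge_sign k S * wedge_sign l (S :\ k) =
  - (wedge_sign l S * wedge_sign k (S :\ l)).
Proof.
move=> kS lS kl; rewrite (wedge_signD1 k lS) (wedge_signD1 l kS) (dir_ltNlt kl).
by case: (dir_lt k l); rewrite /= ?expr0 ?expr1 ?mul1r; ring.
Qed.

(** The pair [(x, S)] is the cube with lowest corner [x] spanned by the directions in [S]. *)
Local Notation cochain := {ffun grid * {set dir} -> R}.

(* [wedge (step k) k] is the left cup product with the basic cubical
   1-cochain dx_k, and [wedge id k] is the exterior product with the constant
   form dx_k: cup products differ from wedge products by translations. *)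
Definition wedge (T : grid -> grid) (k : dir) (f : cochain) : cochain :=
  [ffun z : grid * {set dir} => if k \in z.2 then wedge_sign k z.2 * f (T z.1, z.2 :\ k) else 0].

Lemma wedge_is_additive T k : zmod_morphism (wedge T k).
Proof.
move=> f g; apply/ffunP => z; rewrite !ffunE.
by case: ifP; rewrite ?subr0 // mulrBr.
Qed.
HB.instance Definition _ T k :=
  GRing.isZmodMorphism.Build cochain cochain (wedge T k) (wedge_is_additive T k).

Lemma wedge_anticomm T T' k l f : (forall x, T (T' x) = T' (T x)) ->
  wedge T k (wedge T' l f) = - wedge T' l (wedge T k f).
Proof.
move=> TT'; apply/ffunP => -[x S]; rewrite !ffunE /= !inE.
case: (eqVneq k l) => [<-|kl]; first by case: ifP; rewrite /= ?mulr0 oppr0.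
rewrite /=; case: ifP => kS; case: ifP => lS; rewrite ?mulr0 ?oppr0 //.
by rewrite !mulrA wedge_sign_swap // TT' mulNr !finset.setDDl finset.setUC.
Qed.

Definition scale_fun (a : grid -> R) (f : cochain) : cochain :=
  [ffun z : grid * {set dir} => a z.1 * f z].

Lemma scale_fun_is_additive a : zmod_morphism (scale_fun a).
Proof. by move=> f g; apply/ffunP => z; rewrite !ffunE mulrBr. Qed.
HB.instance Definition _ a :=
  GRing.isZmodMorphism.Build cochain cochain (scale_fun a) (scale_fun_is_additive a).

Lemma wedge_scale_fun T k a f :
  wedge T k (scale_fun a f) = scale_fun (a \o T) (wedge T k f).
Proof.
apply/ffunP => z; rewrite !ffunE /=.
by case: ifP => _; rewrite ?mulr0 // mulrCA.
Qed.

Local Notation cup k := (wedge (step k) k).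
Local Notation ext k := (wedge id k).

(** The partial difference in direction [k], written through two products so that its sign rules all
    follow from [wedge_anticomm]. *)
Definition dcomp (k : dir) (f : cochain) : cochain := cup k f - ext k f.

Lemma dcomp_is_additive k : zmod_morphism (dcomp k).
Proof. by move=> f g; rewrite /dcomp !raddfB /= addrACA. Qed.
HB.instance Definition _ k :=
  GRing.isZmodMorphism.Build cochain cochain (dcomp k) (dcomp_is_additive k).

Definition coboundary (f : cochain) : cochain := \sum_k dcomp k f.

Lemma coboundary_is_additive : zmod_morphism coboundary.
Proof. by move=> f g; rewrite /coboundary -sumrB; apply: eq_bigr => k _; rewrite raddfB. Qed.
HB.instance Definition _ :=
  GRing.isZmodMorphism.Build cochain cochain coboundary coboundary_is_additive.

Lemma cup_anticomm k l f : cup k (cup l f) = - cup l (cup k f).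
Proof. by apply: wedge_anticomm => x; rewrite stepC. Qed.

Lemma ext_cup k l f : ext k (cup l f) = - cup l (ext k f).
Proof. exact: wedge_anticomm. Qed.

Lemma cup_dcomp k l f : cup k (dcomp l f) = - dcomp l (cup k f).
Proof. by rewrite /dcomp raddfB /= cup_anticomm ext_cup opprK opprD. Qed.

Lemma ext_dcomp k l f : ext k (dcomp l f) = - dcomp l (ext k f).
Proof.
by rewrite /dcomp raddfB /= ext_cup (@wedge_anticomm id id k l) // -opprD.
Qed.

Lemma dcomp_anticomm k l f : dcomp k (dcomp l f) = - dcomp l (dcomp k f).
Proof.
rewrite -[LHS]/(cup k (dcomp l f) - ext k (dcomp l f)) cup_dcomp ext_dcomp -opprD.
by rewrite -raddfB.
Qed.

Lemma opp_self_eq0 (f : cochain) : f = - f -> f = 0.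
Proof.
move=> h; apply/ffunP => z; have /ffunP/(_ z) := h; rewrite !ffunE => hz.
by lra.
Qed.

Lemma coboundary_coboundary f : coboundary (coboundary f) = 0.
Proof.
apply: opp_self_eq0; rewrite /coboundary.
under eq_bigr do rewrite raddf_sum.
rewrite {2}exchange_big -sumrN; apply: eq_bigr => k _ /=.
by rewrite -sumrN; apply: eq_bigr => l _ /=; exact: dcomp_anticomm.
Qed.

(** Stokes on a closed manifold: in each direction the two terms cancel after translating the torus
    by one step. *)
Lemma sum_coboundary (f : cochain) : \sum_x coboundary f (x, [set: dir]) = 0.
Proof.
under eq_bigr do rewrite /coboundary sum_ffunE.
rewrite exchange_big /= big1 // => k _.
under eq_bigr do rewrite !ffunE /= inE.
by apply/eqP; rewrite sumrB subr_eq0 eq_sym (reindex_inj (@step_inj k)) /=.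
Qed.

(** * Cup products with a constant 2-form and with the coboundary of a 1-cochain *)

Section connection.
Variables (eps : 'I_m -> R).

(** Left cup product with the constant 2-form, the sum of [eps j] dx_j dy_j. *)
Definition const_curv (f : cochain) : cochain :=
  \sum_j scale_fun (fun=> eps j) (cup (j, false) (cup (j, true) f)).

Lemma const_curv_is_additive : zmod_morphism const_curv.
Proof.
move=> f g; rewrite /const_curv -sumrB; apply: eq_bigr => j _.
by rewrite !raddfB.
Qed.
HB.instance Definition _ :=
  GRing.isZmodMorphism.Build cochain cochain const_curv const_curv_is_additive.

Lemma dcomp_scale k a f :
  dcomp k (scale_fun (fun=> a) f) = scale_fun (fun=> a) (dcomp k f).
Proof. by rewrite /dcomp !wedge_scale_fun raddfB. Qed.

Lemma coboundary_const_curv f :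
  coboundary (const_curv f) = const_curv (coboundary f).
Proof.
rewrite /coboundary /const_curv.
under eq_bigr do rewrite raddf_sum /=.
rewrite exchange_big; apply: eq_bigr => j _ /=; rewrite !raddf_sum.
by apply: eq_bigr => k _; rewrite /= dcomp_scale cup_dcomp raddfN /= cup_dcomp opprK.
Qed.

Section one_connection.
Variable b : dir -> grid -> R.

Definition cup1 (f : cochain) : cochain := \sum_k scale_fun (b k) (cup k f).

(** Left cup product with the coboundary of the 1-cochain [b]: antisymmetrizing in [k] and [l] turns
    the coefficient into the circulation of [b] around a square. *)
Definition curvature (f : cochain) : cochain :=
  \sum_k \sum_l scale_fun (fun x => b k x + b l (step k x)) (cup k (cup l f)).

(** The Leibniz rule (db) f = d(b f) + b (df). *)
Lemma curvatureE f :
  curvature f = coboundary (cup1 f) + cup1 (coboundary f).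
Proof.
rewrite /coboundary /cup1.
under [X in _ = X + _]eq_bigr do rewrite raddf_sum /=.
under [X in _ = _ + X]eq_bigr do rewrite !raddf_sum /=.
(* Each summand is a Leibniz term plus an error mixing [ext] and [cup]; the errors cancel in pairs,
   since [ext] and [cup] anticommute. *)
have split3 : forall k l, scale_fun (fun x => b k x + b l (step k x)) (cup k (cup l f)) =
    dcomp k (scale_fun (b l) (cup l f)) + scale_fun (b k) (cup k (dcomp l f)) +
    (scale_fun (b l) (ext k (cup l f)) + scale_fun (b k) (cup k (ext l f))).
  move=> k l; rewrite /dcomp !raddfB /= !wedge_scale_fun.
  by apply/ffunP => z; rewrite !ffunE /=; ring.
rewrite /curvature (eq_bigr _ (fun k _ => eq_bigr _ (fun l _ => split3 k l))) /=.
under eq_bigr do rewrite big_split /=; rewrite big_split /=.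
have -> : \sum_k \sum_l (scale_fun (b l) (ext k (cup l f)) + scale_fun (b k) (cup k (ext l f))) = 0.
  under eq_bigr do rewrite big_split /=; rewrite big_split /=.
  rewrite [X in _ + X]exchange_big -big_split /= big1 // => k _.
  by rewrite -big_split /= big1 // => l _; rewrite ext_cup raddfN /= addNr.
rewrite addr0 -big_split /=; apply: eq_bigr => k _; exact: big_split.
Qed.

(** Left cup product with the constant 2-form minus the coboundary of [b], a cohomologous cochain
    that may vanish locally. *)
Definition twisted (f : cochain) : cochain := const_curv f - curvature f.

Lemma cup1B : zmod_morphism cup1.
Proof.
by move=> f g; rewrite /cup1 -sumrB; apply: eq_bigr => k _; rewrite !raddfB.
Qed.

Lemma cup10 : cup1 0 = 0.
Proof. by have := cup1B 0 0; rewrite !subrr. Qed.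

Lemma curvatureB : zmod_morphism curvature.
Proof.
move=> f g; rewrite /curvature -sumrB; apply: eq_bigr => k _.
by rewrite -sumrB; apply: eq_bigr => l _; rewrite !raddfB.
Qed.

Lemma twistedD f g : twisted (f - g) = twisted f - twisted g.
Proof. by rewrite /twisted raddfB /= curvatureB !opprD addrACA. Qed.

Lemma coboundary_twisted f : coboundary (twisted f) = twisted (coboundary f).
Proof.
rewrite /twisted raddfB /= coboundary_const_curv; congr (_ - _).
rewrite !curvatureE raddfD /= !coboundary_coboundary add0r.
by rewrite cup10 addr0.
Qed.

(** Value of the constant 2-form on the oriented square spanned by [k] and [l]; [curl] is the value
    of the coboundary of [b] there. *)
Definition kappa (k l : dir) : R :=
  if k.1 == l.1 then (~~ k.2 && l.2)%:R * eps k.1 - (k.2 && ~~ l.2)%:R * eps k.1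
  else 0.

Definition curl (k l : dir) (x : grid) : R :=
  b k x + b l (step k x) - b l x - b k (step l x).

(** Only the squares at [x] with both directions in [S] enter this value, and on them the two
    2-cochains agree. *)
Lemma twisted_flat (f : cochain) x (S : {set dir}) :
  (forall k l, k \in S -> l \in S -> k != l -> curl k l x = kappa k l) ->
  twisted f (x, S) = 0.
Proof.
move=> flat; rewrite !ffunE; apply/eqP; rewrite subr_eq0; apply/eqP.
pose E k l := cup k (cup l f) (x, S).
have Ea k l : E k l = - E l k by rewrite /E cup_anticomm ffunE.
have E0 k l : (k \notin S) || (l \notin S) || (k == l) -> E k l = 0.
  rewrite /E !ffunE /= !inE => /orP[/orP[/negbTE->//|/negbTE->]|/eqP->].
    by rewrite andbF mulr0; case: ifP.
  by rewrite eqxx mulr0; case: ifP.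
have -> : curvature f (x, S) = \sum_k \sum_l (b k x + b l (step k x)) * E k l.
  rewrite sum_ffunE; apply: eq_bigr => k _; rewrite sum_ffunE.
  by apply: eq_bigr => l _; rewrite [LHS]ffunE.
have -> : const_curv f (x, S) = \sum_j eps j * E (j, false) (j, true).
  by rewrite sum_ffunE; apply: eq_bigr => j _; rewrite [LHS]ffunE.
have two : (2 : R) != 0 by rewrite pnatr_eq0.
(* Doubling counts every pair of directions in both orders, which replaces the coefficients of
   [curvature] by the antisymmetric [curl]. *)
apply: (mulfI two).
have -> : 2 * (\sum_k \sum_l (b k x + b l (step k x)) * E k l) =
    \sum_k \sum_l curl k l x * E k l.
  rewrite mulr_natl mulr2n {2}exchange_big -big_split /=; apply: eq_bigr => k _.
  by rewrite -big_split /=; apply: eq_bigr => l _; rewrite /curl (Ea l k); ring.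
have -> : \sum_k \sum_l curl k l x * E k l = \sum_k \sum_l kappa k l * E k l.
  apply: eq_bigr => k _; apply: eq_bigr => l _.
  have [h|] := boolP ((k \notin S) || (l \notin S) || (k == l)).
    by rewrite E0 // !mulr0.
  by rewrite !negb_or !negbK => /andP[/andP[kS lS] kl]; rewrite flat.
have sum_dir (g : dir -> R) : \sum_k g k = \sum_i \sum_c g (i, c).
  by rewrite pair_bigA; apply: eq_bigr => -[].
rewrite sum_dir mulr_sumr.
apply: eq_bigr => j _.
have E1 c : \sum_l kappa (j, c) l * E (j, c) l =
    \sum_d kappa (j, c) (j, d) * E (j, c) (j, d).
  rewrite sum_dir (bigD1 j) //= [X in _ + X]big1 ?addr0 // => i ij.
  by rewrite big1 // => d _; rewrite /kappa /= eq_sym (negbTE ij) mul0r.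
under eq_bigr do rewrite E1.
rewrite !big_bool /kappa /= eqxx /= (Ea (j, true) (j, false)).
by rewrite (Ea (j, true) (j, true)); ring.
Qed.

End one_connection.

Definition unit_cochain : cochain := [ffun z : grid * {set dir} => (z.2 == finset.set0)%:R].

Lemma coboundary_unit : coboundary unit_cochain = 0.
Proof.
rewrite /coboundary big1 // => k _; apply/ffunP => -[x S]; rewrite !ffunE /=.
by rewrite subrr.
Qed.

(** Expansion of the [k]-th power of the sum of [eps j] dx_j dy_j: any remaining index of [P] may
    come next, whence the factorial. *)
Lemma iter_const_curv_unit k x (P : {set 'I_m}) : #|P| = k ->
  iter k const_curv unit_cochain (x, [set d : dir | d.1 \in P]) =
  k`!%:R * \prod_(j in P) eps j.
Proof.
elim: k x P => [|k IH] x P Pk.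
  rewrite ffunE /= (cards0_eq Pk) big_set0 mulr1.
  by rewrite (_ : [set _ | _] = finset.set0) ?eqxx //; apply/setP => d; rewrite !inE.
rewrite iterS sum_ffunE.
transitivity (\sum_i (i \in P)%:R * (k`!%:R * \prod_(j in P) eps j)); last first.
  rewrite -mulr_suml -natr_sum -big_mkcond /= sum1_card Pk mulrA -natrM.
  by rewrite factS.
apply: eq_bigr => j _; rewrite [LHS]ffunE !ffunE /= !inE /=.
case: ifP => jP; last by rewrite mul0r mulr0.
rewrite jP /= mul1r.
set S := [set d : dir | d.1 \in P].
have -> : S :\ (j, false) :\ (j, true) = [set d : dir | d.1 \in P :\ j].
  apply/setP => -[i c]; rewrite !inE /= !xpair_eqE.
  by case: eqP => //= _; case: c.
rewrite IH; last by move: Pk; rewrite (cardsD1 j) jP => -[].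
rewrite (wedge_signD1 (j, false) (l := (j, true))) ?inE ?jP //.
rewrite /dir_lt /= ltnn eqxx /= expr0 mul1r.
(* In the order of directions [(j, true)] comes immediately after [(j, false)], so both signs count
   the same directions and multiply to 1. *)
have -> : wedge_sign (j, true) (S :\ (j, false)) = wedge_sign (j, false) (S :\ (j, true)).
  rewrite /wedge_sign; congr (_ ^+ #|pred_of_set _|); apply/setP => -[i c].
  rewrite !inE /dir_lt /= !xpair_eqE.
  by case: (eqVneq i j) => [->|_] /=; rewrite ?ltnn; case: c; rewrite /= ?andbF ?orbF ?andbT.
have -> : (j, true) != (j, false) by rewrite xpair_eqE andbF.
rewrite [in RHS](bigD1 j) //= (mulrA (wedge_sign _ _)) -expr2 /wedge_sign sqrr_sign mul1r.
rewrite mulrCA; congr (_ * (_ * _)).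
by apply: eq_bigl => i; rewrite !inE andbC.
Qed.

Lemma foldr_twisted_exact (bs : seq (dir -> grid -> R)) (f h : cochain) :
  foldr twisted (f - coboundary h) bs =
  foldr twisted f bs - coboundary (foldr twisted h bs).
Proof.
by elim: bs => //= b bs ->; rewrite twistedD coboundary_twisted.
Qed.

(** Changing one factor of a product of closed cochains by a coboundary changes the product by a
    coboundary, whose sum over the torus is zero. *)
Lemma sum_foldr_twisted (bs : seq (dir -> grid -> R)) (f : cochain) :
  coboundary f = 0 ->
  \sum_x foldr twisted f bs (x, [set: dir]) =
  \sum_x iter (size bs) const_curv f (x, [set: dir]).
Proof.
elim/last_ind: bs f => [//|bs b IH] f df.
rewrite size_rcons iterSr -cats1 foldr_cat /=.
have -> : twisted b f = const_curv f - coboundary (cup1 b f).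
  by rewrite /twisted curvatureE df cup10 addr0.
rewrite foldr_twisted_exact -IH; last by rewrite coboundary_const_curv df raddf0.
set h := coboundary _; transitivity (\sum_x (foldr twisted (const_curv f) bs (x, [set: dir]) - h (x, [set: dir]))).
  by apply: eq_bigr => x _; rewrite [LHS]ffunE [X in _ + X]ffunE.
by rewrite sumrB sum_coboundary subr0.
Qed.

(** The pairs [(shift J x, S)] with [J] and [S] disjoint are the faces of the unit cube at [x]; a
    cup product on a face involves only faces of that face. *)
Lemma twisted_local (b : dir -> grid -> R) (f : cochain) x :
  (forall (J S : {set dir}), [disjoint J & S] -> f (shift J x, S) = 0) ->
  forall (J S : {set dir}), [disjoint J & S] -> twisted b f (shift J x, S) = 0.
Proof.
move=> f0 J S JS.
have cup0 k l : cup k (cup l f) (shift J x, S) = 0.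
  rewrite !ffunE /=; case: ifP => // kS; case: ifP => [|_]; last by rewrite mulr0.
  rewrite !inE => /andP[lk lS].
  have nJ i : i \in S -> i \notin J by move=> iS; rewrite (disjointFl JS iS).
  rewrite step_shift ?nJ // step_shift ?inE ?negb_or ?lk ?nJ // f0 ?mulr0 //.
  rewrite -finset.setI_eq0; apply/eqP/setP => i; rewrite !inE.
  by case: eqP => //= _; case: eqP => //= _; case: (boolP (i \in S)) => [/nJ/negbTE->|_]; rewrite ?andbF.
rewrite [LHS]ffunE [X in _ + X]ffunE sum_ffunE big1 => [|j _]; last first.
  by rewrite [LHS]ffunE cup0 mulr0.
rewrite sum_ffunE big1 ?subr0 // => k _; rewrite sum_ffunE big1 // => l _.
by rewrite [LHS]ffunE cup0 mulr0.
Qed.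

(** At every cube one of the [m] factors vanishes, so the product of all is zero; but its sum over
    the torus is that of the top power of the constant 2-form, which is not. *)
Lemma no_flat_cover (b : 'I_m -> dir -> grid -> R) :
  (forall j, eps j != 0) ->
  ~ (forall x, exists i, forall (J : {set dir}) k l, k \notin J -> l \notin J -> k != l ->
      curl (b i) k l (shift J x) = kappa k l).
Proof.
move=> eps0 flat.
have /eqP := sum_foldr_twisted (map b (enum 'I_m)) coboundary_unit.
rewrite big1 => [|x _]; last first.
  have [i fl] := flat x.
  have : i \in enum 'I_m by rewrite mem_enum.
  have -> : x = shift finset.set0 x by apply/ffunP => k; rewrite ffunE inE.
  have : [disjoint (finset.set0 : {set dir}) & [set: dir]] by rewrite -finset.setI_eq0 finset.set0I.
  (* The factors applied before the flat one are arbitrary, [twisted_flat] gives zero at the flat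
     one, and [twisted_local] carries the zero through the later ones. *)
  move: finset.set0 [set: dir]; elim: (enum 'I_m) => //= j s IH J S JS.
  rewrite inE => /orP[/eqP <-|js].
    apply: twisted_flat => k l kS lS kl.
    by apply: fl => //; rewrite (disjointFl JS).
  apply: twisted_local => // J' S' JS'; exact: IH.
rewrite size_map size_enum_ord eq_sym => /eqP.
under eq_bigr => x _.
  rewrite (_ : [set: dir] = [set d : dir | d.1 \in [set: 'I_m]]); last first.
    by apply/setP => d; rewrite !inE.
  rewrite iter_const_curv_unit ?cardsT ?card_ord //.
  over.
rewrite big_const /= iter_addr_0 => /eqP.
rewrite mulrn_eq0 card_ffun card_ord expn_eq0 /= mulf_eq0 pnatr_eq0.
rewrite (gtn_eqF (fact_gt0 m)) /=.
by move/prodf_eq0 => [j _]; rewrite (negbTE (eps0 j)).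
Qed.

End connection.
End discrete_torus.

Local Open Scope classical_set_scope.
Local Open Scope complex_scope.
Local Open Scope quotient_scope.

(** * Complex-valued continuous functions and angles *)

Section complex_topology.
Variable R : realType.
Local Notation C := (R[i]^o).

Lemma real_complex_continuous : continuous (fun a : R => (a%:C : C)).
Proof.
move=> a; apply/cvgrPdist_lt => e e0.
have e_real : (complex.Re e)%:C = e by apply: RRe_real; exact: gtr0_real.
have : 0 < complex.Re e by rewrite -ltcR e_real.
move=> /(@cvgr_dist_lt _ R^o _ (nbhs (a : R^o)) _ id a cvg_id); apply: filterS => b ab.
by rewrite -rmorphB /= -e_real normc_def /= expr0n addr0 sqrtr_sqr ltcR.
Qed.

Lemma conj_continuous : continuous (fun z : C => (Num.conj (z : R[i]) : C)).
Proof.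
move=> z; apply/(@cvgrPdist_lt _ C C (nbhs z)) => e e0.
near=> w; rewrite -rmorphB norm_conjC; near: w.
exact: (@cvgr_dist_lt _ C _ (nbhs z) _ id z cvg_id e e0).
Unshelve. all: by end_near. Qed.

(* [R[i]] itself carries no topology, only its regular module does *)
Definition ccont (T : topologicalType) (x : T) (f : T -> R[i]) : Prop :=
  continuous_at x (f : T -> C).

Section ccont_theory.
Variables (T : topologicalType) (x : T).

Lemma ccont_cst (c : R[i]) : ccont x (fun=> c).
Proof. exact: cst_continuous. Qed.

Lemma ccont_conj (f : T -> R[i]) : ccont x f -> ccont x (fun y => Num.conj (f y)).
Proof.
move=> cf; exact: (@continuous_comp _ _ _ (f : T -> C) (fun z : C => (Num.conj (z : R[i]) : C)) x cf (@conj_continuous _)).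
Qed.

Lemma ccont_real (f : T -> R) : continuous_at x f -> ccont x (fun y => (f y)%:C).
Proof.
move=> cf; exact: (@continuous_comp _ _ _ f (fun a : R => (a%:C : C)) x cf (@real_complex_continuous _)).
Qed.

Lemma ccontM (f g : T -> R[i]) : ccont x f -> ccont x g -> ccont x (fun y => f y * g y).
Proof. exact: (@cvgM C T (nbhs x) _ f g). Qed.

Lemma ccontD (f g : T -> R[i]) : ccont x f -> ccont x g -> ccont x (fun y => f y + g y).
Proof. exact: (@cvgD C C T (nbhs x) _ f g). Qed.

Lemma ccont_sum (I : Type) (r : seq I) (P : pred I) (F : I -> T -> R[i]) :
  (forall i, ccont x (F i)) -> ccont x (fun y => \sum_(i <- r | P i) F i y).
Proof.
move=> cF; elim: r => [|i r IH].
  by under eq_fun do rewrite big_nil; exact: ccont_cst.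
under eq_fun do rewrite big_cons; case: (P i); last exact: IH.
by apply: ccontD; [exact: cF|exact: IH].
Qed.

End ccont_theory.

(** * Angles of complex numbers, measured in full turns *)

Definition cis (x : R) : R[i] := cos (pi *+ 2 * x) +i* sin (pi *+ 2 * x).

Lemma cisD x y : cis (x + y) = cis x * cis y.
Proof.
rewrite /cis mulrDr cosD sinD; apply/eqP; rewrite eq_complex /= eqxx /=.
by rewrite addrC [sin _ * _]mulrC.
Qed.

Lemma cis0 : cis 0 = 1.
Proof. by rewrite /cis mulr0 cos0 sin0. Qed.

Lemma cis1 : cis 1 = 1.
Proof. by rewrite /cis mulr1 cos2pi sin2pi. Qed.

Lemma conj_cis x : Num.conj (cis x) = cis (- x).
Proof. by rewrite /cis mulrN cosN sinN. Qed.

Lemma norm_cis x : `|cis x| = 1.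
Proof. by rewrite normc_def /= cos2Dsin2 sqrtr1. Qed.

Lemma cis_neq0 x : cis x != 0.
Proof. by rewrite -normr_eq0 norm_cis oner_eq0. Qed.

Lemma cis_continuous (x : R) : ccont x cis.
Proof.
have -> : cis = fun y => (cos (pi *+ 2 * y))%:C + 'i%C * (sin (pi *+ 2 * y))%:C.
  by apply/funext => y; rewrite {1}(complexE (cis y)).
have clin : continuous_at x (fun y : R => pi *+ 2 * y).
  by apply: cvgM; [exact: cvg_cst|exact: cvg_id].
apply: ccontD.
  apply: ccont_real; apply: continuous_comp; first exact: clin.
  exact: continuous_cos.
apply: ccontM; first exact: ccont_cst.
apply: ccont_real; apply: continuous_comp; first exact: clin.
exact: continuous_sin.
Qed.

(** From cos(2 pi x) = 1 follows sin(pi x) = 0, while sine is positive on (0, pi). *)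
Lemma cis_eq1 x : `|x| < 1 -> cis x = 1 -> x = 0.
Proof.
move=> x1 /eqP; rewrite eq_complex /= => /andP[/eqP cx _].
have : sin (pi * x) = 0.
  have : cos (pi * x + pi * x) = 1 by rewrite -cx; congr cos; rewrite mulr2n; ring.
  rewrite cosD; have := cos2Dsin2 (pi * x); move: (cos _) (sin _) => c s h1 h2.
  by apply/eqP; rewrite -sqrf_eq0; apply/eqP; lra.
have p0 := pi_gt0 R.
case: (ltrgtP x 0) => // x0 s0.
- have : 0 < sin (pi * (- x)).
    apply: sin_gt0_pi; rewrite pmulr_rgt0 // oppr_gt0 x0 /= gtr_pMr //.
    by move: x1; rewrite ltr0_norm.
  by rewrite mulrN sinN s0 oppr0 ltxx.
- have : 0 < sin (pi * x).
    by apply: sin_gt0_pi; rewrite pmulr_rgt0 // x0 /= gtr_pMr //; move: x1; rewrite gtr0_norm.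
  by rewrite s0 ltxx.
Qed.

(** The angle of [z] in full turns, correct on the right half-plane only. *)
Definition turn (z : R[i]) : R := atan (complex.Im z / complex.Re z) / (pi *+ 2).

Lemma turnE z : 0 < complex.Re z -> z = `|z| * cis (turn z).
Proof.
case: z => a b /= a0; rewrite normc_def /turn /cis /=.
have p0 : pi *+ 2 != 0 :> R by rewrite mulrn_eq0 /= gt_eqF // pi_gt0.
rewrite ![pi *+ 2 * _]mulrC !divfK //.
set t := b / a.
have bE : b = a * t by rewrite /t mulrC divfK // gt_eqF.
clearbody t.
have c0 : 0 < cos (atan t).
  by rewrite cos_atan invr_gt0 sqrtr_gt0; have := sqr_ge0 t; lra.
have sE : sin (atan t) = cos (atan t) * t.
  by rewrite -{3}(atanK t) /tan mulrC divfK // gt_eqF.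
have nE : Num.sqrt (a ^+ 2 + b ^+ 2) = a / cos (atan t).
  rewrite cos_atan invrK bE.
  have -> : a ^+ 2 + (a * t) ^+ 2 = a ^+ 2 * (1 + t ^+ 2) by ring.
  by rewrite sqrtrM ?sqr_ge0 // sqrtr_sqr gtr0_norm.
rewrite nE sE; apply/eqP; rewrite eq_complex /=.
rewrite !mul0r subr0 addr0; apply/andP; split; apply/eqP; rewrite ?{1}bE; field; exact: lt0r_neq0.
Qed.

(** The disc of radius rho/4 around rho lies in the sector of angles less than pi/4, an eighth of a
    turn. *)
Lemma turn_small (z : R[i]) (rho : R) : 0 < rho -> `|z - rho%:C| < (rho / 4)%:C ->
  0 < complex.Re z /\ `|turn z| < 8^-1.
Proof.
case: z => a b rho0; rewrite normc_def /= ltcR => h.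
have h2 : (a - rho) ^+ 2 + (b - 0) ^+ 2 < (rho / 4) ^+ 2.
  have : 0 <= (a - rho) ^+ 2 + (b - 0) ^+ 2 by rewrite addr_ge0 ?sqr_ge0.
  move=> /sqr_sqrtr <-; rewrite ltr_pXn2r // nnegrE ?sqrtr_ge0 //; lra.
have sq (u v : R) : 0 < v -> u ^+ 2 < v ^+ 2 -> - v < u < v.
  by move=> v0 uv; apply/andP; split; rewrite ltNge; apply/negP => ?; nra.
have a3 : - (rho / 4) < a - rho < rho / 4.
  by apply: sq; [lra|apply: le_lt_trans h2; rewrite lerDl sqr_ge0].
have b3 : - (rho / 4) < b - 0 < rho / 4.
  by apply: sq; [lra|apply: le_lt_trans h2; rewrite lerDr sqr_ge0].
have a0 : 0 < a by lra.
have [b1 b2] : b < a /\ - a < b by split; lra.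
split=> //; rewrite /turn /= ltr_norml.
have p0 := pi_gt0 R; have p2 : 0 < pi *+ 2 :> R by rewrite pmulrn_lgt0.
have := @lt_atan R (b / a) 1; have := @lt_atan R (-1) (b / a).
rewrite atanN atan1 ltr_pdivrMr // mul1r ltr_pdivlMr // mulN1r.
move=> /(_ b2) l1 /(_ b1) l2.
rewrite ltr_pdivlMr // ltr_pdivrMr //; move: l1 l2 p0; move: (atan _) (pi : R) => t p l1 l2 p0.
by apply/andP; split; rewrite mulr2n; lra.
Qed.

(** The two sides agree modulo full turns. Four angles below 1/8 and [phi] below 1/2 leave a
    difference of less than one turn, hence zero. *)
Lemma turn_add (z1 z2 z3 z4 c1 c2 : R[i]) (phi rho : R) : 0 < rho -> `|phi| < 2^-1 ->
  0 < c1 -> 0 < c2 ->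
  `|z1 - rho%:C| < (rho / 4)%:C -> `|z2 - rho%:C| < (rho / 4)%:C ->
  `|z3 - rho%:C| < (rho / 4)%:C -> `|z4 - rho%:C| < (rho / 4)%:C ->
  z1 * z2 * c1 = z3 * z4 * c2 * cis phi ->
  turn z1 + turn z2 - turn z3 - turn z4 = phi.
Proof.
move=> r0 phi2 c10 c20 /turn_small-/(_ r0)[p1 t1] /turn_small-/(_ r0)[p2 t2].
move=> /turn_small-/(_ r0)[p3 t3] /turn_small-/(_ r0)[p4 t4] E.
have nz (z : R[i]) : 0 < complex.Re z -> `|z| != 0.
  by rewrite normr_eq0; apply: contraTneq => ->; rewrite ltxx.
have norms : `|z1| * `|z2| * c1 = `|z3| * `|z4| * c2.
  have := congr1 Num.norm E; rewrite !normrM norm_cis mulr1.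
  by rewrite (gtr0_norm c10) (gtr0_norm c20).
apply/eqP; rewrite -subr_eq0; apply/eqP; apply: cis_eq1.
  by move: t1 t2 t3 t4 phi2; rewrite !ltr_norml; lra.
have E' : `|z1| * `|z2| * c1 * (cis (turn z1) * cis (turn z2)) =
          `|z3| * `|z4| * c2 * (cis (turn z3) * cis (turn z4) * cis phi).
  transitivity (z1 * z2 * c1); first by rewrite [z1 in RHS]turnE // [z2 in RHS]turnE //; ring.
  by rewrite E [z3 in LHS]turnE // [z4 in LHS]turnE //; ring.
move: E'; rewrite norms => /(mulfI (mulf_neq0 (mulf_neq0 (nz _ p3) (nz _ p4)) (lt0r_neq0 c20))) E'.
rewrite (_ : _ - phi = turn z1 + turn z2 + (- (turn z3 + turn z4 + phi))); last by ring.
rewrite cisD (cisD (turn z1)) E'.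
by rewrite -!cisD addrN cis0.
Qed.

End complex_topology.
Arguments ccont : simpl never.

(** * Quasi-periodic functions on the torus *)

Section torus_points.
Variables (R : realType) (m : nat).

Local Notation pt := ('rV[R]_m * 'rV[R]_m)%type.
Local Notation dir := (dir m).

Definition crd (p : pt) (d : dir) : R := if d.2 then p.2 0 d.1 else p.1 0 d.1.

Definition pt_of (c : dir -> R) : pt :=
  (\row_j c (j, false), \row_j c (j, true)).

Lemma crd_pt_of c d : crd (pt_of c) d = c d.
Proof. by case: d => j [] /=; rewrite /crd /= mxE. Qed.

Lemma pt_ext p q : crd p =1 crd q -> p = q.
Proof.
case: p q => [x y] [x' y'] pq; congr (_, _); apply/rowP => j.
  exact: (pq (j, false)).
exact: (pq (j, true)).
Qed.

Definition bump (p : pt) (d : dir) : pt := pt_of (fun d' => crd p d' + (d' == d)%:R).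

Definition box (p : pt) (r : R) : set pt := [set q | forall d, `|crd p d - crd q d| < r].

Lemma box_ball (p q : pt) (r : R) : 0 < r -> box p r q -> ball p r q.
Proof.
move=> r0 pq; split; split => // i j; rewrite ord1.
  exact: (pq (j, false)).
exact: (pq (j, true)).
Qed.

Lemma ball_box (p q : pt) (r : R) : ball p r q -> box p r q.
Proof.
case=> -[r0 h1] [_ h2] [j []]; rewrite /crd /=.
  exact: (h2 0 j).
exact: (h1 0 j).
Qed.

Definition cube : set pt := [set p | forall d, 0 <= crd p d <= 1].

Lemma cube_compact : compact cube.
Proof.
have -> : cube = [set v : 'rV[R]_m | forall i, `[0, 1]%classic (v 0 i)] `*`
                 [set v : 'rV[R]_m | forall i, `[0, 1]%classic (v 0 i)].
  apply/seteqP; split => p /=.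
    move=> h; split => j; rewrite /= in_itv /=; [exact: (h (j, false))|exact: (h (j, true))].
  case=> h1 h2 [j []]; rewrite /crd /=.
    by have := h2 j; rewrite /= in_itv.
  by have := h1 j; rewrite /= in_itv.
have h := @rV_compact R m (fun=> `[0, 1]%classic) (fun=> @segment_compact R 0 1).
exact: (compact_setX h h).
Qed.

(** The number [rho] is the squared modulus of [s p], the value of the product at q = q' = p and a =
    0. *)
Lemma local_small (s : pt -> R[i]) (p : pt) : ccont p s -> s p != 0 ->
  exists2 rho : R, 0 < rho & exists2 r : R, 0 < r &
    forall (q q' : pt) (a : R), box p r q -> box p r q' -> `|a| < r ->
    `|s q * Num.conj (s q') * cis (- a) - rho%:C| < (rho / 4)%:C.
Proof.
move=> cs sp0.
pose F (t : (pt * pt) * R) : R[i] := s t.1.1 * Num.conj (s t.1.2) * cis (- t.2).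
have c1 : continuous_at ((p, p), 0 : R) (fun t : (pt * pt) * R => t.1.1).
  by apply: (@continuous_comp _ _ _ fst fst); [exact: cvg_fst|exact: cvg_fst].
have c2 : continuous_at ((p, p), 0 : R) (fun t : (pt * pt) * R => t.1.2).
  by apply: (@continuous_comp _ _ _ fst snd); [exact: cvg_fst|exact: cvg_snd].
have cF : ccont ((p, p), 0 : R) F.
  apply: ccontM; first apply: ccontM.
  - exact: (@continuous_comp _ _ R[i]^o (fun t : (pt * pt) * R => t.1.1) s).
  - apply: ccont_conj.
    exact: (@continuous_comp _ _ R[i]^o (fun t : (pt * pt) * R => t.1.2) s).
  - apply: (@continuous_comp _ _ R[i]^o (fun t : (pt * pt) * R => - t.2) (@cis R)).
      by apply: cvgN; exact: cvg_snd.
    exact: cis_continuous.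
pose rho := complex.Re (s p * Num.conj (s p)).
have rhoE : s p * Num.conj (s p) = rho%:C.
  by rewrite /rho RRe_real // -normCK rpredX // normr_real.
have rho0 : 0 < rho.
  by rewrite -ltcR -rhoE -normCK exprn_gt0 // normr_gt0.
exists rho => //.
have e0 : 0 < (rho / 4)%:C by rewrite ltcR; lra.
have : nbhs (((p, p), 0 : R) : (pt * pt) * R)
    [set t | `|F ((p, p), 0) - F t| < (rho / 4)%:C].
  exact: (@cvgr_dist_lt _ R[i]^o _ _ _ F (F ((p, p), 0)) cF _ e0).
move=> /(nbhs_ballP _ _)[r /= r0 hr]; exists r => // q q' a pq pq' ar.
have := hr ((q, q'), a); rewrite /F /= oppr0 cis0 mulr1 rhoE distrC; apply.
split => /=; first by split; apply: box_ball.
by rewrite /ball /= sub0r normrN.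
Qed.

Section quasi_periodic.
Variable eps : 'I_m -> R.

(** These are the sections of a line bundle over the torus with first Chern class, up to sign, the
    sum of [eps j] dx_j dy_j. The rule for y_j is asked on the face y_j = 0 only, where
    [test_factor] obeys it. *)
Definition quasi_periodic (s : pt -> R[i]) : Prop :=
  (forall (p : pt) j, s (bump p (j, false)) = s p) /\
  (forall (p : pt) j, crd p (j, true) = 0 ->
     s (bump p (j, true)) = cis (eps j * crd p (j, false)) * s p).

(** * The discretized connection on a cubical mesh *)

Section mesh.
Variable K : nat.
Local Notation h := ((K.+1)%:R^-1 : R).

Definition pos (N : dir -> nat) : pt := pt_of (fun d => (N d)%:R * h).

Definition incr (k : dir) (N : dir -> nat) (d : dir) : nat := (N d + (d == k))%N.

(** Integral along the edge of the connection form, the sum of [eps j] y_j dx_j; subtracting it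
    makes [ratio] periodic. *)
Definition gauge (k : dir) (N : dir -> nat) : R :=
  if k.2 then 0 else eps k.1 * (N (k.1, true))%:R * h ^+ 2.

Definition ratio (s : pt -> R[i]) (k : dir) (N : dir -> nat) : R[i] :=
  s (pos (incr k N)) * Num.conj (s (pos N)) * cis (- gauge k N).

Definition zeroed (W : seq dir) (N : dir -> nat) (d : dir) : nat :=
  if d \in W then 0%N else N d.

Section wrap.
Variables (s : pt -> R[i]) (sP : quasi_periodic s).

Lemma pos_wrap (N : dir -> nat) (d : dir) : N d = K.+1 ->
  pos N = bump (pos (zeroed [:: d] N)) d.
Proof.
move=> Nd; apply: pt_ext => d'; rewrite !crd_pt_of /zeroed inE.
case: eqVneq => [->|_]; last by rewrite addr0.
by rewrite Nd mul0r add0r divff // pnatr_eq0.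
Qed.

(** Along an x_j-edge, going from y_j = 0 to y_j = 1 multiplies the two values of [s] by phases
    [eps j] h turns apart, and [gauge] grows by the same amount. *)
Lemma ratio_wrap1 (N : dir -> nat) (k d : dir) : N d = K.+1 -> d != k ->
  ratio s k N = ratio s k (zeroed [:: d] N).
Proof.
case: sP => sx sy Nd dk; set N' := zeroed _ _.
have Nd' : incr k N d = K.+1 by rewrite /incr Nd (negbTE dk) addn0.
have E' : zeroed [:: d] (incr k N) = incr k N'.
  apply/funext => d'; rewrite /zeroed /incr /N' /zeroed inE.
  by case: eqVneq => [->|//]; rewrite (negbTE dk).
rewrite /ratio (pos_wrap Nd) (pos_wrap Nd') E' -/N'.
case: d => j [] in Nd dk Nd' N' E' *; last first.
  rewrite !sx; congr (_ * cis (- _)); rewrite /gauge /N' /zeroed inE.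
  by case: ifP => //= _; rewrite xpair_eqE andbF.
have y0 N0 : N0 (j, true) = 0%N -> crd (pos N0) (j, true) = 0.
  by move=> N00; rewrite crd_pt_of N00 mul0r.
rewrite !sy; last 2 first.
- by rewrite y0 // /N' /zeroed inE eqxx.
- by rewrite y0 // /incr /N' /zeroed inE eqxx (negbTE dk).
rewrite rmorphM /= conj_cis.
set a := cis (eps j * _); set b := cis (- (eps j * _)).
have -> : forall u v w : R[i], a * u * (b * v) * w = u * v * (a * b * w) by move=> u v w; ring.
congr (_ * _); rewrite /a /b -!cisD; congr cis.
have x1 N0 : crd (pos N0) (j, false) = (N0 (j, false))%:R * h by rewrite crd_pt_of.
rewrite !x1 /incr /gauge /N' /zeroed !inE !xpair_eqE andbF.
have pe i c : ((j, false) == (i, c) :> dir) = (j == i) && (false == c) by [].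
case: k dk {Nd' E' a b} => i [] /= dk; rewrite pe /= ?andbF ?andbT.
  by rewrite addn0 oppr0 addr0 subrr.
have [ij|ij] := eqVneq i j; last first.
  by rewrite addn0 subrr add0r.
rewrite ij addn1 Nd -natr1.
have hK : (K.+1)%:R * h = 1 by rewrite divff // pnatr_eq0.
have -> : eps j * (K.+1)%:R * h ^+ 2 = eps j * h * ((K.+1)%:R * h) by ring.
by rewrite hK; ring.
Qed.

Lemma ratio_wrap (W : seq dir) (N : dir -> nat) (k : dir) :
  (forall d, d \in W -> N d = K.+1) -> k \notin W ->
  ratio s k N = ratio s k (zeroed W N).
Proof.
elim: W => [//|d W IH] WN; rewrite inE negb_or => /andP[kd kW].
rewrite IH // => [|d' d'W]; last by rewrite WN // inE d'W orbT.
have [dW|dW] := boolP (d \in W).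
  congr ratio; apply/funext => d'; rewrite /zeroed inE.
  by case: eqVneq => [->|//]; rewrite dW.
rewrite (@ratio_wrap1 _ _ d) 1?eq_sym //; last first.
  by rewrite /zeroed (negbTE dW) WN // inE eqxx.
congr ratio; apply/funext => d'; rewrite /zeroed !inE.
by case: eqVneq.
Qed.

(** Corners of the cube at [x], not reduced modulo K + 1, so that they remain close to each other as
    points. *)
Definition unwrapped (J : {set dir}) (x : grid m K) (d : dir) : nat := (x d + (d \in J))%N.

Lemma ratio_shift (J : {set dir}) (x : grid m K) (k : dir) : k \notin J ->
  ratio s k (fun d => shift J x d) = ratio s k (unwrapped J x).
Proof.
move=> kJ; rewrite (@ratio_wrap [seq d <- enum dir | (d \in J) && (x d == ord_max)] (unwrapped J x)) //.
- congr ratio; apply/funext => d; rewrite ffunE /zeroed mem_filter mem_enum andbT /unwrapped.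
  case: (d \in J) => /=; last by rewrite addn0.
  rewrite -val_eqE /= addn1; case: eqVneq => [->|xK]; first by rewrite modnn.
  by rewrite modn_small // ltnS ltn_neqAle xK -ltnS ltn_ord.
- by move=> d; rewrite mem_filter => /andP[/andP[dJ /eqP xd] _]; rewrite /unwrapped dJ xd addn1.
- by rewrite mem_filter (negbTE kJ).
Qed.

End wrap.

Lemma unwrapped_incr (J : {set dir}) (x : grid m K) (k : dir) : k \notin J ->
  unwrapped (k |: J) x = incr k (unwrapped J x).
Proof.
move=> kJ; apply/funext => d; rewrite /unwrapped /incr !inE -addnA; congr (_ + _)%N.
by case: eqVneq => [->|_]; rewrite ?(negbTE kJ) ?addn0.
Qed.

Lemma pos_unwrapped_close (J : {set dir}) (x : grid m K) d :
  `|crd (pos (fun d => x d)) d - crd (pos (unwrapped J x)) d| <= h.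
Proof.
rewrite !crd_pt_of /unwrapped natrD mulrDl opprD addrA subrr add0r normrN.
have h0 : 0 <= h by rewrite invr_ge0.
by case: (d \in J); rewrite ?mul0r ?normr0 // mul1r ger0_norm.
Qed.

Lemma gauge_small (J : {set dir}) (x : grid m K) k : (forall j, `|eps j| = 1) ->
  `|gauge k (unwrapped J x)| <= h.
Proof.
move=> eps1; have h0 : 0 <= h by rewrite invr_ge0.
rewrite /gauge; case: ifP => _; first by rewrite normr0.
rewrite -mulrA normrM eps1 mul1r ger0_norm ?mulr_ge0 ?exprn_ge0 // expr2 mulrA ler_piMl //.
rewrite ler_pdivrMr ?ltr0n // mul1r ler_nat /unwrapped.
by have := ltn_ord (x (k.1, true)); case: (_ \in _) => /=; lia.
Qed.

(** Discrete form of d(y dx) = - dx dy. *)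
Lemma gauge_curl (N : dir -> nat) k l : k != l ->
  - gauge k N - gauge l (incr k N) =
  - gauge l N - gauge k (incr l N) + kappa (fun j => eps j * h ^+ 2) k l.
Proof.
move=> kl; rewrite /gauge /kappa /incr.
have pe (i j : 'I_m) c : ((i, true) == (j, c) :> dir) = (i == j) && (true == c) by [].
case: k l kl => [i [|]] [j [|]] kl /=; rewrite ?pe /= ?andbF ?andbT ?addn0 ?mul0r ?mul1r ?subrr ?oppr0 ?addr0 ?subr0 ?sub0r //.
- by case: ifP; rewrite addr0.
- case: (eqVneq i j) => [->|ij] /=; last by rewrite addn0 addr0.
  by rewrite addn1 -natr1; ring.
- case: (eqVneq i j) => [->|ij] /=; last by rewrite addn0 addr0.
  by rewrite addn1 -natr1; ring.
- by case: ifP => _; ring.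
Qed.

End mesh.

(** On a fine mesh the angles of the ratios of [s i] form a 1-cochain whose circulation is exactly
    the constant 2-form around each cube where [s i] varies little, against [no_flat_cover]. *)
Theorem no_quasi_periodic_cover (s : 'I_m -> pt -> R[i]) :
  (forall j, `|eps j| = 1) -> (forall i, quasi_periodic (s i)) ->
  ~ (forall p, cube p -> exists i, ccont p (s i) /\ s i p != 0).
Proof.
move=> eps1 sP cover.
(* On mesh [K], some [s i] varies so little around [p] that all its ratios there are within rho/4 of
   a positive rho. The bound [0 < K] gives h at most 1/2. *)
pose good (K : nat) (p : pt) := (0 < K)%N /\ exists i, exists2 rho : R, 0 < rho &
  forall (q q' : pt) (a : R), (forall d, `|crd p d - crd q d| <= (K.+1)%:R^-1) ->
    (forall d, `|crd p d - crd q' d| <= (K.+1)%:R^-1) -> `|a| <= (K.+1)%:R^-1 ->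
    `|s i q * Num.conj (s i q') * cis (- a) - rho%:C| < (rho / 4)%:C.
have [K goodK] : exists K, forall p, cube p -> good K p.
  have /compact_near_coveringP nc := cube_compact.
  suff : \forall K \near \oo, cube `<=` good K by move=> /filter_ex[K]; exists K.
  apply: nc => p /cover[i [ci si0]].
  have [rho rho0 [r r0 hr]] := local_small ci si0.
  have r20 : 0 < r / 2 by rewrite divr_gt0.
  exists (ball p (r / 2), [set K | (0 < K)%N] `&` [set K | (K.+1)%:R^-1 < r / 2]).
    split; first exact: nbhsx_ballx.
    apply: filterI; first exact: nbhs_infty_gt.
    exact: (near_infty_natSinv_lt (PosNum r20)).
  move=> [q K] /= [/ball_box pq [K0 hK]]; split => //.
  exists i, rho => // q1 q2 a h1 h2 ha.
  have tri (q' : pt) : (forall d, `|crd q d - crd q' d| <= (K.+1)%:R^-1) -> box p r q'.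
    move=> h' d; rewrite (splitr r) -(subrK (crd q d) (crd p d)) -addrA.
    apply: le_lt_trans (ler_normD _ _) _; apply: ltrD; first exact: pq.
    exact: le_lt_trans (h' d) hK.
  apply: hr; [exact: tri|exact: tri|].
  by apply: le_lt_trans ha _; apply: lt_trans hK _; lra.
pose h := (K.+1)%:R^-1 : R.
have h0 : 0 < h by rewrite invr_gt0 ltr0n.
pose b i k (x : grid m K) := turn (ratio K (s i) k (fun d => x d)).
have eps'0 j : eps j * h ^+ 2 != 0.
  by apply: mulf_neq0; [rewrite -normr_gt0 eps1|rewrite expf_neq0 // gt_eqF].
apply: (@no_flat_cover R m K (fun j => eps j * h ^+ 2) b eps'0) => x.
have [|K0 [i [rho rho0 H]]] := goodK (pos K (fun d => x d)).
  move=> d; rewrite crd_pt_of mulr_ge0 ?invr_ge0 //= ler_pdivrMr ?ltr0n // mul1r.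
  by rewrite ler_nat ltnW.
exists i => J k l kJ lJ kl.
have kJl : k \notin l |: J by rewrite !inE negb_or kl.
have lJk : l \notin k |: J by rewrite !inE negb_or eq_sym kl.
rewrite /curl /b !step_shift // !ratio_shift //.
have small (J' : {set dir}) k' : k' \notin J' ->
    `|ratio K (s i) k' (unwrapped J' x) - rho%:C| < (rho / 4)%:C.
  move=> k'J'; rewrite /ratio -unwrapped_incr //; apply: H.
  - exact: pos_unwrapped_close.
  - exact: pos_unwrapped_close.
  - exact: gauge_small.
set N := unwrapped J x.
pose Sk := s i (pos K (incr k N)); pose Sl := s i (pos K (incr l N)).
have nz (z : R[i]) : `|z - rho%:C| < (rho / 4)%:C -> z != 0.
  move=> hz; have [+ _] := turn_small rho0 hz.
  by apply: contraTneq => ->; rewrite ltxx.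
have Sk0 : Sk != 0.
  have := nz _ (small J k kJ); apply: contraNneq => Sk0.
  by rewrite /ratio -/N -/Sk Sk0 !mul0r.
have Sl0 : Sl != 0.
  have := nz _ (small J l lJ); apply: contraNneq => Sl0.
  by rewrite /ratio -/N -/Sl Sl0 !mul0r.
(* The two ways around the square give products of ratios that differ by the squared modulus at the
   intermediate corner and by the phase [kappa]; hence the positive factors. *)
apply: (@turn_add R _ _ _ _ (`|Sl| ^+ 2) (`|Sk| ^+ 2) _ rho) => //; try exact: small.
- have h12 : h <= 2^-1.
    by rewrite lef_pV2 ?posrE ?ltr0n // ler_nat.
  have : `|kappa (fun j => eps j * h ^+ 2) k l| <= h ^+ 2.
    rewrite /kappa; have := eps1 k.1; case: ifP => _ e1; last by rewrite normr0 sqr_ge0.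
    have he : `|eps k.1 * h ^+ 2| = h ^+ 2 by rewrite normrM e1 mul1r ger0_norm ?sqr_ge0.
    have h2 := sqr_ge0 h.
    by case: (k.2); case: (l.2); rewrite /= ?mul1r ?mul0r ?subr0 ?sub0r ?normrN ?normr0 ?he.
  by move=> /le_lt_trans; apply; nra.
- by rewrite exprn_gt0 // normr_gt0.
- by rewrite exprn_gt0 // normr_gt0.
- rewrite !unwrapped_incr // -/N.
  have NE : incr l (incr k N) = incr k (incr l N).
    by apply/funext => d; rewrite /incr addnAC.
  rewrite /ratio -/Sk -/Sl NE !normCK.
  have gc := congr1 (@cis R) (gauge_curl K N kl).
  rewrite !cisD in gc.
  set T := s i (pos K (incr k (incr l N))); set S0 := Num.conj (s i _).
  transitivity (T * S0 * (Sk * Num.conj Sk) * (Sl * Num.conj Sl) *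
     (cis (- gauge K k N) * cis (- gauge K l (incr k N)))); first by ring.
  by rewrite gc; ring.
Qed.

End quasi_periodic.
End torus_points.

(** * Topology of the complex projective space *)

Section projective_topology.
Variables (R : realType) (n : nat).
Local Notation vec := 'rV[R[i]^o]_n.+1.
Local Notation CP := (CP R n).
Local Notation nzv := (@nonzero_vector R n).

Lemma ccontV (T : topologicalType) (x : T) (f : T -> R[i]) : f x != 0 ->
  ccont x f -> ccont x (fun y => (f y)^-1).
Proof. by move=> fx cf; exact: (@cvgV R[i]^o). Qed.

Lemma ccont_near_neq0 (T : topologicalType) (x : T) (f : T -> R[i]) : f x != 0 ->
  ccont x f -> \forall y \near x, f y != 0.
Proof. by move=> fx cf; exact: (@cvgr_neq0 R[i]^o R[i]^o _ _ _ _ _ cf). Qed.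

Lemma ccont_coord (a : 'I_n.+1) (v : vec) : ccont v (fun w : vec => w 0 a).
Proof. exact: coord_continuous. Qed.

Lemma row_continuous_at (T : topologicalType) (x : T) (f : T -> vec) :
  (forall a, ccont x (fun y => f y 0 a)) -> continuous_at x f.
Proof.
move=> cf A [P hP PA]; rewrite nbhs_simpl /=.
have : \forall y \near x, forall a, P 0 a (f y 0 a).
  by apply: filter_forall => a; apply: cf; exact: hP.
by apply: filterS => y hy; apply: PA => i a; rewrite ord1.
Qed.

Lemma ccont_comp (T U : topologicalType) (x : T) (f : T -> U) (g : U -> R[i]) :
  continuous_at x f -> ccont (f x) g -> ccont x (g \o f).
Proof. by move=> cf cg; exact: (@continuous_comp _ _ R[i]^o f g). Qed.

Lemma ones_neq0 : (const_mx 1 : vec) \in nzv.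
Proof.
apply/mem_set => /=; apply/eqP => /matrixP/(_ 0 0); rewrite !mxE => /eqP.
by rewrite oner_eq0.
Qed.

(* the value at [v = 0] is irrelevant *)
Definition line (v : vec) : CP :=
  \pi_CP (insubd (exist (fun v => v \in nzv) _ ones_neq0 : nzv) v).

Definition rep (x : CP) : vec := set_val (repr x).

Lemma rep_neq0 x : rep x != 0.
Proof. exact: (set_valP (repr x)). Qed.

Lemma repK : cancel rep line.
Proof. by move=> x; rewrite /line /rep valKd reprK. Qed.

Lemma lineP (v w : vec) : v != 0 -> w != 0 ->
  line v = line w <-> exists2 a : R[i], a != 0 & v = a *: w.
Proof.
move=> v0 w0; have vE : v \in nzv by apply/mem_set.
have wE : w \in nzv by apply/mem_set.
split.
  move=> /(@eqquotP _ (proportional_equiv R n) {eq_quot (proportional_equiv R n)}).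
  by move=> /asboolP; rewrite /set_val /= !insubdK.
move=> avw; apply/(@eqquotP _ (proportional_equiv R n) {eq_quot (proportional_equiv R n)}).
by apply/asboolP; rewrite /set_val /= !insubdK.
Qed.

Lemma vec_neq0P (v : vec) : v != 0 -> exists a, v 0 a != 0.
Proof.
move=> v0; apply/existsP; apply: contraNT v0; rewrite negb_exists => /forallP h.
by apply/eqP/rowP => a; rewrite mxE; apply/eqP; have := h a; rewrite negbK.
Qed.

Lemma vec_near_neq0 (v : vec) : v != 0 -> \forall w \near v, w != 0.
Proof.
move=> /vec_neq0P[a va]; have := ccont_near_neq0 va (@ccont_coord a v).
by apply: filterS => w; apply: contraNneq => ->; rewrite mxE.
Qed.

Lemma line_continuous_at (v : vec) : v != 0 -> continuous_at v line.
Proof.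
move=> v0; apply: (@continuous_comp _ _ _ _ (\pi_CP)); last exact: pi_continuous.
move=> A /=; rewrite nbhs_simpl /=.
rewrite nbhsE /= => -[B [[V oV <-] /= Vv] BA].
rewrite /set_val /= insubdK ?inE // in Vv; near=> w; apply: BA => /=.
rewrite /set_val /= insubdK; first by near: w; exact: open_nbhs_nbhs.
by rewrite inE; near: w; exact: vec_near_neq0.
Unshelve. all: by end_near. Qed.

Definition sqnorm (v : vec) : R[i] := \sum_c v 0 c * Num.conj (v 0 c).

Lemma sqnorm_gt0 v : v != 0 -> 0 < sqnorm v.
Proof.
move=> /vec_neq0P[a va]; rewrite /sqnorm (bigD1 a) //= ltr_pwDl //.
  by rewrite -normCK exprn_gt0 // normr_gt0.
by apply: sumr_ge0 => c _; rewrite -normCK exprn_ge0.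
Qed.

Lemma sqnormZ a v : sqnorm (a *: v) = a * Num.conj a * sqnorm v.
Proof.
rewrite /sqnorm mulr_sumr; apply: eq_bigr => c _.
by rewrite mxE rmorphM /= mulrACA.
Qed.

(** Entries of the orthogonal projector onto the line: independent of the representative, they serve
    as continuous coordinates on CP^n. *)
Definition proj_entry (x : CP) (a b : 'I_n.+1) : R[i] :=
  rep x 0 a * Num.conj (rep x 0 b) / sqnorm (rep x).

Lemma proj_entry_line (v : vec) a b : v != 0 ->
  proj_entry (line v) a b = v 0 a * Num.conj (v 0 b) / sqnorm v.
Proof.
move=> v0; rewrite /proj_entry; have /(lineP (rep_neq0 _) v0)[c c0 ->] := repK (line v).
rewrite sqnormZ !mxE rmorphM /=.
have s0 := lt0r_neq0 (sqnorm_gt0 v0).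
have c'0 : Num.conj c != 0 by rewrite conjC_eq0.
by field; rewrite s0 c0 andbT; exact: c'0.
Qed.

Lemma proj_entry_continuous a b (x : CP) : ccont x (fun y => proj_entry y a b).
Proof.
suff : continuous (fun y : CP => (proj_entry y a b : R[i]^o)) by exact.
apply/quotient_continuous => v /=.
have v0 := set_valP v; rewrite /nonzero_vector /= in v0.
have -> : (fun y : CP => (proj_entry y a b : R[i]^o)) \o \pi_CP =
    (fun w : vec => w 0 a * Num.conj (w 0 b) / sqnorm w) \o
      (set_val : nzv -> vec).
  apply/funext => w /=; have w0 : set_val w != 0 := set_valP w.
  by rewrite -proj_entry_line // /line valKd.
apply: ccont_comp; first exact: initial_continuous.
apply: ccontM; first apply: ccontM.
- exact: ccont_coord.
- by apply: ccont_conj; exact: ccont_coord.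
- apply: ccontV; first exact: lt0r_neq0 (sqnorm_gt0 _).
  apply: ccont_sum => c; apply: ccontM; first exact: ccont_coord.
  by apply: ccont_conj; exact: ccont_coord.
Qed.

(** A nonzero column of the projector spans the line. *)
Lemma proj_entry_inj x y : (forall a b, proj_entry x a b = proj_entry y a b) -> x = y.
Proof.
move=> xy; rewrite -(repK x) -(repK y); apply/(lineP (rep_neq0 _) (rep_neq0 _)).
have [b yb] := vec_neq0P (rep_neq0 y).
have sx := lt0r_neq0 (sqnorm_gt0 (rep_neq0 x)); have sy := lt0r_neq0 (sqnorm_gt0 (rep_neq0 y)).
have xb : rep x 0 b != 0.
  have : proj_entry y b b != 0 by rewrite /proj_entry !mulf_neq0 ?conjC_eq0 ?invr_eq0.
  by rewrite -xy; apply: contraNneq => xb; rewrite /proj_entry xb !mul0r.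
have xb' : Num.conj (rep x 0 b) != 0 by rewrite conjC_eq0.
have yb' : Num.conj (rep y 0 b) != 0 by rewrite conjC_eq0.
exists (Num.conj (rep y 0 b) * sqnorm (rep x) / (sqnorm (rep y) * Num.conj (rep x 0 b))).
  by rewrite !mulf_neq0 ?invr_eq0 ?mulf_neq0.
apply/rowP => a; rewrite mxE; apply: (mulIf xb'); apply: (mulIf (invr_neq0 sx)).
rewrite -[LHS]/(proj_entry x a b) xy /proj_entry.
by field; rewrite xb' sy sx.
Qed.

Lemma CP_separated (x y : CP) : x <> y ->
  exists A B : set CP, [/\ open A, open B, A x, B y & A `&` B = set0].
Proof.
move=> xy.
have [a [b ab]] : exists a b, proj_entry x a b != proj_entry y a b.
  apply: contrapT => h; apply: xy; apply: proj_entry_inj => a b; apply/eqP.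
  by apply: contrapT => /negP ab; apply: h; exists a, b.
have := @norm_hausdorff _ R[i]^o; rewrite open_hausdorff => /(_ _ _ ab).
move=> -[[A B] /= [xA yB] [oA oB AB]].
rewrite !inE in xA yB.
have cf : continuous (fun y : CP => (proj_entry y a b : R[i]^o)) by move=> z; exact: proj_entry_continuous.
exists ((fun y : CP => (proj_entry y a b : R[i]^o)) @^-1` A), ((fun y : CP => (proj_entry y a b : R[i]^o)) @^-1` B).
split => //; [by apply: open_comp => // z _; exact: cf|by apply: open_comp => // z _; exact: cf|].
by rewrite -preimage_setI; move/eqP : AB => ->; rewrite preimage_set0.
Qed.

End projective_topology.

(** * Paths chosen by a symmetric motion planner *)

Section motion_planner.
Variables (R : realType) (X : topologicalType).
Hypothesis X_separated : forall x y : X, x <> y ->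
  exists A B : set X, [/\ open A, open B, A x, B y & A `&` B = set0].
Local Notation path := (free_path R X).
Local Notation interval := (@unit_interval R).

Lemma open_path_set (K : set interval) (V : set X) : compact K -> open V ->
  open [set g : path | forall t, K t -> V (g t)].
Proof.
move=> cK oV; exists [set g : {compact-open, interval -> X} | g @` K `<=` V].
  exact: compact_open_open.
apply/seteqP; split => g /=; first by move=> h t Kt; apply: h; exists t.
by move=> h _ [t Kt <-]; exact: h.
Qed.

Lemma orbit_of_open (A : set (@nonloop R X)) : open A ->
  open [set g | A (reverse_nonloop g)] ->
  open (orbit_of (@reverse_nonloopK R X) @` A).
Proof.
move=> oA oA'; rewrite /open /= /quotient_open.
rewrite (_ : _ @^-1` _ = A `|` [set g | A (reverse_nonloop g)]); first exact: openU.
apply/seteqP; split => g /=.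
  move=> [g' Ag' /esym]; rewrite -/(orbit_of (@reverse_nonloopK R X) g).
  by move=> /(@orbit_ofP _ _ (@reverse_nonloopK R X))[->|->]; [left|right; rewrite /= reverse_nonloopK].
case=> [Ag|Ag]; first by exists g.
by exists (reverse_nonloop g) => //; apply/(@orbit_ofP _ _ (@reverse_nonloopK R X)); right.
Qed.

Variables (U : set (unordered_pairs X)) (sg : U -> unordered_paths R X).
Hypotheses (oU : open U) (csg : continuous sg) (sgK : forall b : U, ev2 (sg b) = set_val b).

(** [sg] chooses a path up to reversal; prescribing the endpoints in order selects the
    orientation. *)
Definition planned (x y : X) (g : path) : Prop :=
  ev g = (x, y) /\ exists (gn : @nonloop R X) (z : U),
    set_val gn = g /\ orbit_of (@reverse_nonloopK R X) gn = sg z.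

Lemma ev1E (g : @nonloop R X) : set_val (ev1 g) = ev (set_val g).
Proof. by []. Qed.

(** The other representative of the orbit is the reversed path, which would force [x = y]. *)
Lemma planned_uniq x y g g' : planned x y g -> planned x y g' -> g = g'.
Proof.
move=> [xy [gn [z [gE gz]]]] [xy' [gn' [z' [gE' gz']]]].
have zz' : z = z'.
  apply/val_inj; rewrite /= -[LHS](sgK z) -[RHS](sgK z') -gz -gz' !ev2E.
  congr orbit_of; apply/val_inj; rewrite -[LHS]/(ev (set_val gn)) -[RHS]/(ev (set_val gn')).
  by rewrite gE gE' xy.
have : orbit_of (@reverse_nonloopK R X) gn = orbit_of (@reverse_nonloopK R X) gn'.
  by rewrite gz zz'.
move=> /(@orbit_ofP _ _ (@reverse_nonloopK R X))[gg|gg]; first by rewrite -gE gg.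
exfalso; have : off_diagonal X (ev (set_val gn)) := set_valP gn; rewrite gE xy; apply.
have : ev (set_val gn) = ev (reverse_path (set_val gn')) by rewrite gg.
by rewrite ev_reverse_path gE gE' xy xy' => -[].
Qed.

Lemma planned_ex (w : off_diagonal X) : U (orbit_of (@switchK X) w) ->
  exists g, planned (set_val w).1 (set_val w).2 g.
Proof.
move=> Uw; pose z : U := exist (fun b => b \in U) _ (mem_set Uw).
pose gn := orbit_repr (sg z).
have gnz : orbit_of (@reverse_nonloopK R X) gn = sg z by exact: orbit_reprK.
have : orbit_of (@switchK X) (ev1 gn) = orbit_of (@switchK X) w.
  by rewrite -ev2E gnz sgK.
move=> /(@orbit_ofP _ _ (@switchK X))[e|e].
  exists (set_val gn); split; last by exists gn, z.
  by rewrite -ev1E e; case: (set_val w).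
exists (set_val (reverse_nonloop gn)); split.
  rewrite -ev1E ev1_equivariant e switchK.
  by case: (set_val w).
exists (reverse_nonloop gn), z; split => //; rewrite -gnz.
by apply/(@orbit_ofP _ _ (@reverse_nonloopK R X)); right.
Qed.

Lemma backwards_compact (K : set interval) : compact K -> compact (@backwards R @` K).
Proof.
apply: continuous_compact; apply: continuous_subspaceT; exact: backwards_continuous.
Qed.

(** Continuity of [sg] controls paths up to reversal only; disjoint neighbourhoods [A] and [B] of
    the endpoints fix the orientation. *)
Lemma planned_near (x y : X) (g : path) (K : set interval) (V : set X) :
  planned x y g -> compact K -> open V -> (forall t, K t -> V (g t)) ->
  \forall w \near (x, y), exists2 g', planned w.1 w.2 g' & forall t, K t -> V (g' t).
Proof.
move=> [xy [gn [z [gE gz]]]] cK oV KV.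
have gx : g (I0 R) = x by case: xy.
have gy : g (I1 R) = y by case: xy.
have nxy : x <> y.
  by have : off_diagonal X (ev (set_val gn)) := set_valP gn; rewrite gE xy.
have [A [B [oA oB Ax By AB]]] := X_separated nxy.
pose N (h : path) := [/\ forall t, K t -> V (h t), A (h (I0 R)) & B (h (I1 R))].
have oN : open [set h | N h].
  rewrite (_ : [set h | N h] = [set h : path | forall t, K t -> V (h t)] `&`
     ([set h : path | forall t, [set I0 R] t -> A (h t)] `&`
      [set h : path | forall t, [set I1 R] t -> B (h t)])).
    by apply: openI; [|apply: openI]; apply: open_path_set => //; exact: compact_set1.
  apply/seteqP; split => h /=; first by move=> [? ? ?]; split => //; split => _ ->.
  by move=> [? [hA hB]]; split => //; [exact: hA|exact: hB].
(* The image of [N] in the orbit space is open once both [N] and its reversal are. *)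
have oN' : open [set h | N (reverse_path h)].
  rewrite (_ : [set h | N (reverse_path h)] = [set h : path | forall t, (@backwards R @` K) t -> V (h t)] `&`
     ([set h : path | forall t, [set I1 R] t -> A (h t)] `&`
      [set h : path | forall t, [set I0 R] t -> B (h t)])).
    by apply: openI; [|apply: openI]; apply: open_path_set => //; [exact: backwards_compact|exact: compact_set1|exact: compact_set1].
  apply/seteqP; split => h /=.
    move=> [hV]; rewrite /reverse_path /= backwards0 backwards1 => hA hB.
    by split => [_ [t Kt <-]|]; [exact: hV|split => _ ->].
  move=> [hV [hA hB]]; split; rewrite /reverse_path /= ?backwards0 ?backwards1.
  - by move=> t Kt; apply: hV; exists t.
  - exact: hA.
  - exact: hB.
pose W : set (unordered_paths R X) := orbit_of (@reverse_nonloopK R X) @` [set h | N (set_val h)].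
have oW : open W.
  by apply: orbit_of_open; [exists [set h | N h]|exists [set h | N (reverse_path h)]].
have Wz : W (sg z) by exists gn => //=; rewrite gE; split; rewrite ?gx ?gy.
have [V' oV' V'W] : open (sg @^-1` W) by move/continuousP : csg; exact.
have zE : set_val z = orbit_of (@switchK X) (ev1 gn) by rewrite -sgK -gz ev2E.
have oUV : open (U `&` V') by exact: openI.
have UVz : (U `&` V') (orbit_of (@switchK X) (ev1 gn)).
  rewrite -zE; split; first exact: (set_valP z).
  by have : (set_val @^-1` V') z by rewrite V'W.
have [Z oZ ZE] : open (orbit_of (@switchK X) @^-1` (U `&` V')) by exact: oUV.
have Zxy : Z (x, y).
  have : (orbit_of (@switchK X) @^-1` (U `&` V')) (ev1 gn) by exact: UVz.
  by rewrite -ZE -[_ (ev1 gn)]/(Z (ev (set_val gn))) gE xy.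
have nZ : nbhs (x, y) Z by exact: open_nbhs_nbhs.
have nAB : nbhs (x, y) (A `*` B).
  by exists (A, B) => //; split; exact: open_nbhs_nbhs.
near=> w.
have [Aw Bw] : (A `*` B) w by near: w.
have Zw : Z w by near: w.
have ndw : w \in off_diagonal X.
  apply/mem_set => /= ww; have : (A `&` B) w.1 by split => //; rewrite ww.
  by rewrite AB.
pose w' : off_diagonal X := exist (fun x => x \in off_diagonal X) w ndw.
have [Uw V'w] : (U `&` V') (orbit_of (@switchK X) w').
  by have : (set_val @^-1` Z) w' by []; rewrite ZE.
have [g' pg'] := planned_ex Uw; exists g' => //.
have [g'w [hn [z' [hE hz']]]] := pg'.
have z'E : set_val z' = orbit_of (@switchK X) w'.
  rewrite -sgK -hz' ev2E; congr orbit_of; apply/val_inj.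
  by rewrite -[LHS]/(ev (set_val hn)) hE g'w -surjective_pairing.
have : (sg @^-1` W) z' by rewrite -V'W /= z'E.
(* The representative lying in [N] is [g'] or its reverse; the reverse ends at [w.1], which would
   then lie in both [A] and [B]. *)
move=> [h Nh]; have {}Nh : N (set_val h) := Nh; rewrite -hz' => /(@orbit_ofP _ _ (@reverse_nonloopK R X))[hh|hh].
  by move: Nh; rewrite hh hE => -[].
move: Nh; rewrite hh -[set_val _]/(reverse_path (set_val hn)) hE => -[_].
rewrite /reverse_path /= backwards0 backwards1 => Ag' Bg'; exfalso.
have [g'0 g'1] : g' (I0 R) = w.1 /\ g' (I1 R) = w.2 by case: g'w.
have : (A `&` B) w.1 by split => //; rewrite -g'0.
by rewrite AB.
Unshelve. all: by end_near. Qed.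

End motion_planner.

(** * Discrete holonomy along a path *)

Section holonomy.
Variables (R : realType) (n : nat).
Local Notation vec := 'rV[R[i]^o]_n.+1.
Local Notation CP := (CP R n).
Local Notation path := (free_path R CP).
Local Notation interval := (@unit_interval R).

Definition herm (v w : vec) : R[i] := \sum_c Num.conj (v 0 c) * w 0 c.

Lemma herm_self v : herm v v = sqnorm v.
Proof. by apply: eq_bigr => c _; rewrite mulrC. Qed.

(** Trace of the product of the two projectors: it vanishes exactly when the lines are
    orthogonal. *)
Definition overlap (x y : CP) : R[i] :=
  \sum_a \sum_b proj_entry x a b * proj_entry y b a.

Lemma overlapE x y : overlap x y =
  herm (rep x) (rep y) * herm (rep y) (rep x) / (sqnorm (rep x) * sqnorm (rep y)).
Proof.
rewrite /overlap /herm exchange_big /=.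
have sx := lt0r_neq0 (sqnorm_gt0 (rep_neq0 x)); have sy := lt0r_neq0 (sqnorm_gt0 (rep_neq0 y)).
rewrite mulr_suml mulr_suml; apply: eq_bigr => b _.
rewrite mulr_sumr mulr_suml; apply: eq_bigr => a _.
by rewrite /proj_entry; field; rewrite sx sy.
Qed.

Lemma overlap_self x : overlap x x = 1.
Proof.
rewrite overlapE !herm_self divff // mulf_neq0 //; exact: lt0r_neq0 (sqnorm_gt0 (rep_neq0 x)).
Qed.

Definition apply_proj (x : CP) (z : 'I_n.+1 -> R[i]) (a : 'I_n.+1) : R[i] :=
  \sum_b proj_entry x a b * z b.

Lemma apply_proj_rep x y c a : apply_proj x (fun b => c * rep y 0 b) a =
  c * herm (rep x) (rep y) / sqnorm (rep x) * rep x 0 a.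
Proof.
rewrite /apply_proj /herm mulr_sumr !mulr_suml; apply: eq_bigr => b _.
by rewrite /proj_entry; field; exact: lt0r_neq0 (sqnorm_gt0 (rep_neq0 x)).
Qed.

Definition time (r : R) : interval := insubd (I0 R) r.

Lemma timeK (r : R) : 0 <= r <= 1 -> set_val (time r) = r.
Proof.
by move=> r01; rewrite /set_val /time /= insubdK // inE /unit_interval /= in_itv.
Qed.

Lemma time0 : time 0 = I0 R.
Proof. by apply/val_inj; rewrite -[LHS]/(set_val (time 0)) timeK // lexx ler01. Qed.

Lemma time1 : time 1 = I1 R.
Proof. by apply/val_inj; rewrite -[LHS]/(set_val (time 1)) timeK // lexx ler01. Qed.

(** Parallel transport in the tautological bundle, replaced by successive orthogonal projections so
    that it makes sense for merely continuous paths. *)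
Fixpoint transport (M : nat) (g : path) (k : nat) (z : 'I_n.+1 -> R[i]) : 'I_n.+1 -> R[i] :=
  apply_proj (g (time (k%:R / M%:R))) (if k is k'.+1 then transport M g k' z else z).

Definition holonomy (M : nat) (g : path) (u v : vec) : R[i] :=
  \sum_a Num.conj (v 0 a) * transport M g M (fun b => u 0 b) a.

Lemma apply_projZ x z c a : apply_proj x (fun b => c * z b) a = c * apply_proj x z a.
Proof. by rewrite /apply_proj mulr_sumr; apply: eq_bigr => b _; rewrite mulrCA. Qed.

Lemma transportZ M g k z c : transport M g k (fun b => c * z b) = fun a => c * transport M g k z a.
Proof.
elim: k => [|k IH]; apply/funext => a; first exact: apply_projZ.
by rewrite /= IH apply_projZ.
Qed.

(** This is the transformation law of a section of the bundle L, linear in [u] and conjugate linear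
    in [v]. *)
Lemma holonomyZ M g u v (c d : R[i]) :
  holonomy M g (c *: u) (d *: v) = c * Num.conj d * holonomy M g u v.
Proof.
rewrite /holonomy mulr_sumr; apply: eq_bigr => a _.
rewrite (_ : (fun b => (c *: u) 0 b) = fun b => c * u 0 b); last first.
  by apply/funext => b; rewrite mxE.
by rewrite transportZ mxE rmorphM /=; ring.
Qed.

(** Projecting a nonzero vector to a line not orthogonal to it gives a nonzero vector, so the
    transported vector ends as a nonzero multiple of [v]. *)
Lemma holonomy_neq0 M g u v : u != 0 -> v != 0 -> (0 < M)%N ->
  ev g = (line u, line v) ->
  (forall k, (k < M)%N ->
     overlap (g (time (k.+1%:R / M%:R))) (g (time (k%:R / M%:R))) != 0) ->
  holonomy M g u v != 0.
Proof.
move=> u0 v0 M0 evg ovl.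
have g0 : g (I0 R) = line u by case: evg.
have g1 : g (I1 R) = line v by case: evg.
have chain k : (k <= M)%N -> exists2 c : R[i], c != 0 &
    forall a, transport M g k (fun b => u 0 b) a = c * rep (g (time (k%:R / M%:R))) 0 a.
  elim: k => [_|k IH kM].
    have /(lineP u0 (rep_neq0 _))[c c0 uE] := esym (repK (line u)).
    exists c => // a /=; rewrite mul0r time0 g0.
    rewrite (_ : (fun b => u 0 b) = fun b => c * rep (line u) 0 b); last first.
      by apply/funext => b; rewrite {1}uE mxE.
    by rewrite apply_proj_rep herm_self mulfK // lt0r_neq0 // sqnorm_gt0 // rep_neq0.
  have [c c0 cE] := IH (ltnW kM).
  set x := g (time (k.+1%:R / M%:R)); set y := g (time (k%:R / M%:R)) in cE *.
  exists (c * herm (rep x) (rep y) / sqnorm (rep x)).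
    rewrite !mulf_neq0 // ?invr_eq0; last by rewrite lt0r_neq0 // sqnorm_gt0 // rep_neq0.
    by have := ovl k kM; apply: contraNneq => h; rewrite overlapE h !mul0r.
  move=> a; rewrite /= -/x -apply_proj_rep; congr apply_proj.
  by apply/funext => b; rewrite cE.
have [c c0 cE] := chain M (leqnn M).
rewrite divff ?pnatr_eq0 -?lt0n // time1 g1 in cE.
have /(lineP (rep_neq0 _) v0)[d d0 vE] := repK (line v).
rewrite /holonomy (_ : \sum_a _ = c * d * sqnorm v); last first.
  rewrite /sqnorm mulr_sumr; apply: eq_bigr => a _.
  by rewrite cE vE mxE; ring.
by rewrite !mulf_neq0 // lt0r_neq0 // sqnorm_gt0.
Qed.

Lemma ccont_holonomy (T : topologicalType) (p : T) M (g : T -> path) (u v : T -> vec) :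
  (forall t a b, ccont p (fun q => proj_entry (g q t) a b)) ->
  (forall a, ccont p (fun q => u q 0 a)) -> (forall a, ccont p (fun q => v q 0 a)) ->
  ccont p (fun q => holonomy M (g q) (u q) (v q)).
Proof.
move=> cg cu cv.
have ct k a : ccont p (fun q => transport M (g q) k (fun b => u q 0 b) a).
  elim: k a => [|k IH] a; apply: ccont_sum => b; apply: ccontM => //.
apply: ccont_sum => a; apply: ccontM; last exact: ct.
by apply: ccont_conj; exact: cv.
Qed.

Lemma ccont_near_eq (T : topologicalType) (p : T) (f g : T -> R[i]) :
  (\forall q \near p, f q = g q) -> ccont p g -> ccont p f.
Proof.
move=> fg cg; rewrite /ccont /continuous_at (nbhs_singleton fg).
apply: cvg_trans cg; apply: near_eq_cvg.
by move: fg; apply: filterS => q ->.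
Qed.

Lemma overlap_open (x : CP) : exists V : set CP,
  [/\ open V, V x & forall y z, V y -> V z -> overlap y z != 0].
Proof.
have co : ccont ((x, x) : CP * CP) (fun w => overlap w.1 w.2).
  apply: ccont_sum => a; apply: ccont_sum => b; apply: ccontM.
    apply: (@ccont_comp _ _ _ _ fst (fun y : CP => proj_entry y a b)); first exact: cvg_fst.
    exact: proj_entry_continuous.
  apply: (@ccont_comp _ _ _ _ snd (fun y : CP => proj_entry y b a)); first exact: cvg_snd.
  exact: proj_entry_continuous.
have o0 : overlap x x != 0 by rewrite overlap_self oner_neq0.
have [[A B] /= [Ax Bx] AB] :=
  @ccont_near_neq0 R _ (x, x) (fun w : CP * CP => overlap w.1 w.2) o0 co.
have := Ax : nbhs x A; rewrite nbhsE => -[A' [oA' A'x] A'A].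
have := Bx : nbhs x B; rewrite nbhsE => -[B' [oB' B'x] B'B].
exists (A' `&` B'); split; [exact: openI|by []|].
by move=> y z [/A'A Ay _] [_ /B'B Bz]; exact: (AB (y, z)).
Qed.

Lemma interval_compact : compact [set: interval].
Proof.
have /compact_near_coveringP nc := @segment_compact R 0 1.
apply/compact_near_coveringP => J F P FF h.
have : \forall i \near F, `[0, 1]%classic `<=` (fun r => forall t : interval, set_val t = r -> P i t).
  apply: nc => r r01; have r01' : 0 <= r <= 1 by move: r01; rewrite /= in_itv.
  have [[A B] /= [tA FB] AB] := h (time r) I.
  move: tA; rewrite nbhsE => -[A' [[V oV VE] A't] A'A].
  exists (V, B) => /=; first split => //=.
    apply: open_nbhs_nbhs; split => //; rewrite -(timeK r01').
    by have : (set_val @^-1` V) (time r) by rewrite VE.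
  move=> [r' i] /= [Vr' Bi] t tr'; apply: (AB (t, i)); split => //=; apply: A'A.
  by rewrite -VE /= tr'.
apply: filterS => i Pi t _; apply: (Pi (set_val t)) => //.
exact: (set_valP t).
Qed.

(** A Lebesgue number for the cover of the path by open sets of pairwise non-orthogonal lines. *)
Lemma path_mesh (g : path) : exists2 M0 : nat, (0 < M0)%N & forall t : interval,
  exists V : set CP, [/\ open V, forall y z, V y -> V z -> overlap y z != 0 &
    forall t' : interval, `|set_val t - set_val t'| <= M0%:R^-1 -> V (g t')].
Proof.
have /compact_near_coveringP nc := interval_compact.
pose P (M : nat) (t : interval) := exists V : set CP, [/\ open V,
  forall y z, V y -> V z -> overlap y z != 0 &
    forall t' : interval, `|set_val t - set_val t'| <= M.+1%:R^-1 -> V (g t')].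
suff : \forall M \near \oo, [set: interval] `<=` P M.
  by move=> /filter_ex[M h]; exists M.+1 => // t; exact: h.
apply: nc => t0 _.
have [V [oV Vt VV]] := overlap_open (g t0).
have cg : continuous g by exact: cts_fun.
have : nbhs t0 (g @^-1` V) by apply: cg; exact: open_nbhs_nbhs.
rewrite nbhsE => -[A [[W oW WE] At] AV].
have : nbhs (set_val t0) W.
  by apply: open_nbhs_nbhs; split => //; have : (set_val @^-1` W) t0 by rewrite WE.
move=> /(nbhs_ballP _ _)[r /= r0 rW].
have r20 : 0 < r / 2 by rewrite divr_gt0.
exists (set_val @^-1` ball (set_val t0) (r / 2), [set M | (M.+1)%:R^-1 < r / 2]).
  split; last exact: (near_infty_natSinv_lt (PosNum r20)).
  by apply: initial_continuous; exact: nbhsx_ballx.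
move=> [t M] /= [tt0 hM]; exists V; split => // t' tt'; apply: AV; rewrite -WE /=; apply: rW.
move: tt0; rewrite /ball /= => tt0.
rewrite (splitr r) -(subrK (set_val t) (set_val t0)) -addrA.
apply: le_lt_trans (ler_normD _ _) _; apply: ltrD => //.
exact: le_lt_trans tt' hM.
Qed.

End holonomy.

(** * Lower bound *)

Section lower_bound.
Variables (R : realType) (n m : nat).
Local Notation vec := 'rV[R[i]^o]_n.+1.
Local Notation CP := (CP R n).
Local Notation path := (free_path R CP).
Local Notation interval := (@unit_interval R).
Local Notation pt := ('rV[R]_m * 'rV[R]_m)%type.

Variables (u v : pt -> vec) (du dv : 'I_m -> R).
Hypotheses (u0 : forall p, u p != 0) (v0 : forall p, v p != 0).
Hypotheses (cu : forall p a, ccont p (fun q => u q 0 a)).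
Hypotheses (cv : forall p a, ccont p (fun q => v q 0 a)).
Hypotheses (ux : forall p j, u (bump p (j, false)) = u p).
Hypotheses (vx : forall p j, v (bump p (j, false)) = v p).
Hypotheses (uy : forall p j, crd p (j, true) = 0 ->
  u (bump p (j, true)) = cis (du j * crd p (j, false)) *: u p).
Hypotheses (vy : forall p j, crd p (j, true) = 0 ->
  v (bump p (j, true)) = cis (dv j * crd p (j, false)) *: v p).

Local Notation eps := (fun j => du j - dv j).

Lemma line_bump (w : pt -> vec) (dw : 'I_m -> R) p j :
  (forall p, w p != 0) ->
  w (bump p (j, true)) = cis (dw j * crd p (j, false)) *: w p ->
  line (w (bump p (j, true))) = line (w p).
Proof.
by move=> w0 wE; apply/lineP => //; exists (cis (dw j * crd p (j, false))); first exact: cis_neq0.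
Qed.

Lemma lines_continuous p : continuous_at p (fun q => (line (u q), line (v q))).
Proof.
have cl (w : pt -> vec) : (forall p, w p != 0) -> (forall p a, ccont p (fun q => w q 0 a)) ->
    continuous_at p (fun q => line (w q)).
  move=> w0 cw; apply: (@continuous_comp _ _ _ w (@line R n)); first exact: row_continuous_at.
  exact: line_continuous_at.
exact: cvg_pair (cl u u0 cu) (cl v v0 cv).
Qed.

Section one_section.
Variables (U : set (unordered_pairs CP)) (sg : U -> unordered_paths R CP).
Hypotheses (oU : open U) (csg : continuous sg) (sgK : forall b : U, ev2 (sg b) = set_val b).

Local Notation plan p g := (planned sg (line (u p)) (line (v p)) g).

(** The default 0 where no path is planned keeps the function quasi-periodic everywhere. *)
Definition planned_hol (M : nat) (p : pt) : R[i] :=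
  if pselect (exists g, plan p g) is left h then holonomy M (sval (cid h)) (u p) (v p)
  else 0.

Lemma planned_holE M p g : plan p g -> planned_hol M p = holonomy M g (u p) (v p).
Proof.
move=> pg; rewrite /planned_hol; case: pselect => [h|[]]; last by exists g.
by rewrite (planned_uniq sgK (svalP (cid h)) pg).
Qed.

Lemma planned_hol0 M p : ~ (exists g, plan p g) -> planned_hol M p = 0.
Proof. by rewrite /planned_hol; case: pselect. Qed.

Lemma planned_hol_quasi M : quasi_periodic eps (planned_hol M).
Proof.
split=> p j; first by rewrite /planned_hol ux vx.
move=> p0; have [uE vE] := (uy p0, vy p0).
have lu := line_bump u0 uE; have lv := line_bump v0 vE.
have [[g pg]|npg] := pselect (exists g, plan p g).
  have pg' : plan (bump p (j, true)) g by rewrite lu lv.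
  rewrite (planned_holE M pg) (planned_holE M pg') uE vE holonomyZ conj_cis -cisD.
  by congr (cis _ * _); ring.
rewrite !planned_hol0 ?mulr0 //; by rewrite lu lv.
Qed.

(** By [planned_near] at a single time, the projector entries of the planned path at that time
    depend continuously on the point. *)
Lemma planned_hol_ccont M p g : plan p g -> ccont p (planned_hol M).
Proof.
move=> pg.
pose gam (q : pt) : path := if pselect (exists g, plan q g) is left h then sval (cid h) else g.
have gamE q g' : plan q g' -> gam q = g'.
  move=> qg'; rewrite /gam; case: pselect => [h|[]]; last by exists g'.
  exact: (planned_uniq sgK (svalP (cid h)) qg').
have near_plan (K : set interval) (V : set CP) : compact K -> open V ->
    (forall t, K t -> V (g t)) ->
    \forall q \near p, exists2 g', plan q g' & forall t, K t -> V (g' t).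
  move=> cK oV KV.
  exact: (lines_continuous (planned_near (@CP_separated R n) oU csg sgK pg cK oV KV)).
apply: (@ccont_near_eq R _ p _ (fun q => holonomy M (gam q) (u q) (v q))).
  have H := near_plan set0 setT (@compact0 _) openT (fun _ _ => Logic.I).
  near=> q; have [g' qg' _] : exists2 g', plan q g' & forall t, set0 t -> setT (g' t).
    by near: q; exact: H.
  by rewrite (planned_holE M qg') (gamE _ _ qg').
apply: ccont_holonomy => // t a b A /=.
rewrite (gamE _ _ pg) nbhs_simpl nbhsE => -[B [oB Bg] BA].
have H := near_plan [set t] ((fun y : CP => (proj_entry y a b : R[i]^o)) @^-1` B).
have oB' : open ((fun y : CP => (proj_entry y a b : R[i]^o)) @^-1` B).
  by apply: open_comp => // y _; exact: proj_entry_continuous.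
have {}H := H (@compact_set1 _ t) oB' (fun t' tt' => ltac:(by rewrite tt')).
change (\forall q \near p, A (proj_entry (gam q t) a b)).
near=> q; have [g' qg' qB] : exists2 g', plan q g' &
    forall t', [set t] t' -> ((fun y : CP => (proj_entry y a b : R[i]^o)) @^-1` B) (g' t').
  by near: q; exact: H.
by apply: BA; rewrite (gamE _ _ qg'); exact: qB.
Unshelve. all: by end_near. Qed.

Lemma interval_ball_compact (t : interval) (r : R) :
  compact [set t' : interval | `|set_val t - set_val t'| <= r].
Proof.
apply: (@subclosed_compact _ _ [set: interval]) => //; last exact: interval_compact.
rewrite (_ : [set t' | _] = (set_val : interval -> R) @^-1`
   ((fun x : R => `|set_val t - x|) @^-1` [set x | x <= r])) //.
apply: closed_comp; first by move=> x _; exact: initial_continuous.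
apply: closed_comp; last exact: closed_le.
move=> x _; apply: (@continuous_comp _ _ _ (fun x : R => set_val t - x) (@Num.norm _ R)).
  by apply: cvgB; [exact: cvg_cst|exact: cvg_id].
exact: norm_continuous.
Qed.

(** The mesh needed for nonvanishing depends on the path. As factorials are eventually divisible by
    any [M0], one number of steps [j]! will serve the whole compact cube. *)
Lemma planned_hol_good p g : plan p g ->
  \forall q \near p & j \near \oo,
    ccont q (planned_hol j`!) /\ planned_hol j`! q != 0.
Proof.
move=> pg; have [M0 M00 mesh] := path_mesh g.
pose tk (k : 'I_M0) : interval := time (k%:R / M0%:R).
pose V k := sval (cid (mesh (tk k))).
have VP k := svalP (cid (mesh (tk k))); rewrite -/(V _) in VP.
have nearV : \forall q \near p, forall k : 'I_M0, exists2 g', plan q g' &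
    forall t : interval, `|set_val (tk k) - set_val t| <= M0%:R^-1 -> V k (g' t).
  apply: (@filter_forall _ _ _ _ (nbhs_filter p)) => k; have [oV _ Vg] := VP k.
  exact: (lines_continuous (planned_near (@CP_separated R n) oU csg sgK pg
    (@interval_ball_compact _ _) oV Vg)).
exists ([set q | forall k : 'I_M0, exists2 g', plan q g' &
    forall t : interval, `|set_val (tk k) - set_val t| <= M0%:R^-1 -> V k (g' t)],
  [set j | (M0 <= j)%N]).
  by split => //=; exact: nbhs_infty_ge.
move=> [q j] /= [qV M0j].
have [g' qg' _] := qV (Ordinal M00).
split; first exact: planned_hol_ccont qg'.
have {}qV k (t : interval) : `|set_val (tk k) - set_val t| <= M0%:R^-1 -> V k (g' t).
  by have [g'' qg'' h] := qV k; rewrite (planned_uniq sgK qg' qg''); exact: h.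
rewrite (planned_holE _ qg'); apply: holonomy_neq0 => //; first exact: fact_gt0.
  by case: qg'.
move=> l lM.
have /dvdnP[c jE] : (M0 %| j`!)%N by apply: dvdn_fact; rewrite M00.
have c0 : (0 < c)%N by move: (fact_gt0 j); rewrite jE; case: c {jE}.
have kM0 : (l %/ c < M0)%N by rewrite ltn_divLR // mulnC -jE.
have [_ VV _] := VP (Ordinal kM0).
have cR : 0 < c%:R :> R by rewrite ltr0n.
have MR : 0 < M0%:R :> R by rewrite ltr0n.
(* Consecutive times l/j! and (l+1)/j! lie in a common interval [k/M0, (k+1)/M0], with k = l %/ c,
   on which the path stays in one set [V]. *)
have inV l' : (l %/ c * c <= l' <= (l %/ c).+1 * c)%N ->
    V (Ordinal kM0) (g' (time (l'%:R / j`!%:R))).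
  move=> /andP[ll' l'l]; apply: qV.
  have jR : j`!%:R = M0%:R * c%:R :> R by rewrite jE mulnC natrM.
  have d1 : (l %/ c)%:R * c%:R <= l'%:R :> R by rewrite -natrM ler_nat.
  have d2 : l'%:R <= ((l %/ c)%:R + 1) * c%:R :> R by rewrite natr1 -natrM ler_nat.
  have E : l'%:R / j`!%:R = l'%:R / c%:R / M0%:R :> R.
    by rewrite jR; field; rewrite !gt_eqF.
  have d1' : (l %/ c)%:R <= l'%:R / c%:R :> R by rewrite ler_pdivlMr.
  have d2' : l'%:R / c%:R <= (l %/ c)%:R + 1 :> R by rewrite ler_pdivrMr.
  have q1 : (l %/ c)%:R + 1 <= M0%:R :> R by rewrite natr1 ler_nat.
  rewrite !timeK; first last.
  - rewrite E divr_ge0 ?divr_ge0 //= ler_pdivrMr // mul1r; lra.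
  - by rewrite divr_ge0 //= ler_pdivrMr // mul1r ler_nat ltnW.
  rewrite E -mulrBl normrM (gtr0_norm (x := M0%:R^-1)) ?invr_gt0 //.
  by rewrite ler_piMl ?invr_ge0 ?ler0n //= ler_norml; lra.
apply: VV; apply: inV.
  by rewrite (leq_trans (leq_divM _ _)) //= ltn_ceil.
by rewrite leq_divM /= ltnW // ltn_ceil.
Qed.

End one_section.

(** The Hermitian product of [v] and [u] trivializes L near the diagonal. *)
Lemma base_hol_quasi : quasi_periodic eps (fun p => herm (v p) (u p)).
Proof.
split=> p j; first by rewrite ux vx.
move=> p0; rewrite (uy p0) (vy p0) /herm mulr_sumr; apply: eq_bigr => c _.
rewrite !mxE rmorphM /= conj_cis mulrBl cisD; ring.
Qed.

Theorem no_small_section_cover k : (forall j, `|du j - dv j| = 1) -> (k < m)%N ->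
  ~ section_cover (@ev2 R CP) k.
Proof.
move=> eps1 km [U [oU Ucov Usec]].
pose sg i : U i -> unordered_paths R CP := sval (cid (Usec i)).
have csg i : continuous (sg i) := (svalP (cid (Usec i))).1.
have sgK i : forall b : U i, ev2 (sg i b) = set_val b := (svalP (cid (Usec i))).2.
(* Index 0 carries the trivialization near the diagonal, index i + 1 the i-th planner, and further
   indices 0; all planners fit because k < m. *)
pose s (j : nat) (i : 'I_m) (p : pt) : R[i] :=
  if (i : nat) is i'.+1 then
    if insub i' is Some i'' then planned_hol (@sg i'') j`! p else 0
  else herm (v p) (u p).
have sP j i : quasi_periodic eps (s j i).
  rewrite /s; case: (nat_of_ord i) => [|i']; first exact: base_hol_quasi.
  case: insub => [i''|]; first exact: planned_hol_quasi.
  by split=> *; rewrite ?mulr0.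
suff [j hj] : exists j, forall p, cube p -> exists i, ccont p (s j i) /\ s j i p != 0.
  exact: (@no_quasi_periodic_cover R m eps (s j)).
have /compact_near_coveringP nc := @cube_compact R m.
suff : \forall j \near \oo, @cube R m `<=` (fun p => exists i, ccont p (s j i) /\ s j i p != 0).
  by move=> /filter_ex[j hj]; exists j.
apply: nc => p _.
have [uv|uv] := pselect (line (u p) = line (v p)).
  have chol q : ccont q (fun p => herm (v p) (u p)).
    by apply: ccont_sum => c; apply: ccontM => //; apply: ccont_conj.
  have h0 : herm (v p) (u p) != 0.
    have [c c0 ->] := (lineP (u0 p) (v0 p)).1 uv.
    rewrite (_ : herm _ _ = c * sqnorm (v p)); last first.
      by rewrite /sqnorm mulr_sumr; apply: eq_bigr => a _; rewrite mxE; ring.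
    by rewrite mulf_neq0 // lt0r_neq0 // sqnorm_gt0.
  exists ([set q | herm (v q) (u q) != 0], setT).
    by split; [exact: (@ccont_near_neq0 R _ p (fun q => herm (v q) (u q)) h0 (chol p))|exact: filterT].
  move=> [q j] /= [hq _]; exists (Ordinal (leq_ltn_trans (leq0n k) km)); split => //.
have uvd : (line (u p), line (v p)) \in off_diagonal CP by apply/mem_set.
pose w : off_diagonal CP := exist (fun x => x \in off_diagonal CP) _ uvd.
have [i _ Ui] : (\bigcup_i U i) (orbit_of (@switchK CP) w) by rewrite Ucov.
have [g pg] := planned_ex (sgK i) Ui.
have := planned_hol_good (oU i) (csg i) (sgK i) pg; apply: filterS => -[q j] /= h.
have im : (i.+1 < m)%N by exact: leq_ltn_trans (ltn_ord i) km.
by exists (Ordinal im); rewrite /s /= (valK i).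
Qed.

End lower_bound.

(** * The test map from the torus to CP^n *)

Section test_map.
Variables (R : realType) (n m : nat) (f : 'I_n -> 'I_m).
Hypothesis f_inj : injective f.
Local Notation vec := 'rV[R[i]^o]_n.+1.
Local Notation pt := ('rV[R]_m * 'rV[R]_m)%type.

(** At y_j = 0 it is the constant 1 and at y_j = 1 the constant [cis] of x_j: the same line, with
    representatives differing by the phase required in [quasi_periodic]. *)
Definition test_factor (p : pt) (j : 'I_m) : {poly R[i]} :=
  ((1 - crd p (j, true))%:C + (crd p (j, true))%:C * cis (crd p (j, false)))%:P +
  ((crd p (j, true) * (1 - crd p (j, true)))%:C)%:P * 'X.

(* The point [(x, y)] of the torus goes to the line of polynomials with a root
   at the image of [(x, y)] under a degree one map to CP^1; products of such
   polynomials give the map (CP^1)^n -> CP^n of degree n!. *)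
Definition test_poly (p : pt) : {poly R[i]} := \prod_j test_factor p (f j).

Definition test_vec (p : pt) : vec := \row_a (test_poly p)`_a.

Lemma test_factor_coef p j i : (test_factor p j)`_i =
  if i == 0%N then (1 - crd p (j, true))%:C + (crd p (j, true))%:C * cis (crd p (j, false))
  else if i == 1%N then (crd p (j, true) * (1 - crd p (j, true)))%:C else 0.
Proof.
rewrite /test_factor coefD coefC coefMX coefC.
by case: i => [|[|i]] /=; rewrite ?addr0 ?add0r.
Qed.

(** The linear coefficient y (1 - y) vanishes only at y = 0 and y = 1, where the constant term is 1
    or a phase. *)
Lemma test_factor_neq0 p j : test_factor p j != 0.
Proof.
apply/eqP => /polyP h; have := h 0%N; have := h 1%N.
rewrite !test_factor_coef !coef0 /= => /complexI/eqP; rewrite mulf_eq0 => /orP[/eqP->|].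
  by rewrite subr0 mul0r addr0 => /complexI/eqP; rewrite oner_eq0.
rewrite subr_eq0 => /eqP <-; rewrite subrr add0r mul1r => /eqP.
by rewrite (negbTE (cis_neq0 _)).
Qed.

Lemma size_test_poly p : (size (test_poly p) <= n.+1)%N.
Proof.
apply: leq_trans (size_prod_leq _ _) _.
rewrite cardT size_enum_ord.
have : (\sum_(j < n) size (test_factor p (f j)) <= \sum_(j < n) 2)%N.
  apply: leq_sum => j _.
  apply/leq_sizeP => i i2; rewrite test_factor_coef.
  by case: i i2 => [|[|]].
by rewrite sum_nat_const card_ord muln2 -addnn leq_subLR addnS ltnS.
Qed.

Lemma test_vec_neq0 p : test_vec p != 0.
Proof.
have : test_poly p != 0 by apply/prodf_neq0 => j _; exact: test_factor_neq0.
apply: contraNneq => /rowP h; apply/eqP/polyP => i; rewrite coef0.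
have [ni|ni] := ltnP n i; first by rewrite nth_default // (leq_trans (size_test_poly p)).
by have := h (Ordinal (ni : (i < n.+1)%N)); rewrite !mxE.
Qed.

Lemma ccont_crd (p : pt) d : continuous_at p (fun q : pt => crd q d).
Proof.
case: d => j []; rewrite /crd /=.
  apply: (@continuous_comp _ _ _ snd (fun v : 'rV[R]_m => v 0 j)); first exact: cvg_snd.
  exact: coord_continuous.
apply: (@continuous_comp _ _ _ fst (fun v : 'rV[R]_m => v 0 j)); first exact: cvg_fst.
exact: coord_continuous.
Qed.

Lemma ccont_test_factor (p : pt) j i : ccont p (fun q => (test_factor q j)`_i).
Proof.
have cy := @ccont_crd p (j, true).
have c1y : continuous_at p (fun q : pt => 1 - crd q (j, true)).
  by apply: cvgB; [exact: cvg_cst|exact: cy].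
rewrite (_ : (fun q => _) = fun q : pt =>
    if i == 0%N then (1 - crd q (j, true))%:C + (crd q (j, true))%:C * cis (crd q (j, false))
    else if i == 1%N then (crd q (j, true) * (1 - crd q (j, true)))%:C else 0); last first.
  by apply/funext => q; rewrite test_factor_coef.
case: (i == 0%N); last case: (i == 1%N); last exact: ccont_cst.
  apply: ccontD; first exact: ccont_real.
  apply: ccontM; first exact: ccont_real.
  apply: (@ccont_comp _ _ _ p (fun q : pt => crd q (j, false)) (@cis R)); first exact: ccont_crd.
  exact: cis_continuous.
by apply: ccont_real; apply: cvgM; [exact: cy|exact: c1y].
Qed.

Lemma ccont_test_vec (p : pt) a : ccont p (fun q => test_vec q 0 a).
Proof.
rewrite (_ : (fun q => _) = fun q => (test_poly q)`_a); last first.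
  by apply/funext => q; rewrite mxE.
rewrite /test_poly; move: (nat_of_ord a); elim: (index_enum _) => [|j r IH] i.
  rewrite (_ : (fun q => _) = fun=> (1 : {poly R[i]})`_i); first exact: ccont_cst.
  by apply/funext => q; rewrite big_nil.
rewrite (_ : (fun q => _) = fun q => \sum_(k < i.+1)
    (test_factor q (f j))`_k * (\prod_(l <- r) test_factor q (f l))`_(i - k)); last first.
  by apply/funext => q; rewrite big_cons coefM.
apply: ccont_sum => k; apply: ccontM; last exact: IH.
exact: ccont_test_factor.
Qed.

Lemma test_factor_bump p (j k : 'I_m) b : k != j -> test_factor (bump p (j, b)) k = test_factor p k.
Proof.
move=> kj; rewrite /test_factor !crd_pt_of.
have E c : ((k, c) == (j, b) :> dir m) = false by apply/negbTE; apply: contra kj => /eqP[->].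
by rewrite !E !addr0.
Qed.

Lemma test_vec_bumpx p j : test_vec (bump p (j, false)) = test_vec p.
Proof.
suff E k : test_factor (bump p (j, false)) k = test_factor p k.
  by apply/rowP => a; rewrite !mxE /test_poly; under eq_bigr do rewrite E.
have [->|] := eqVneq k j; last exact: test_factor_bump.
rewrite /test_factor !crd_pt_of eqxx.
have -> : ((j, true) == (j, false) :> dir m) = false by apply/negbTE/eqP; case.
by rewrite addr0 cisD cis1 mulr1.
Qed.

(** As [f] is injective, at most one factor involves the j-th T^2, and it is multiplied by the phase
    of x_j. *)
Lemma test_vec_bumpy p j : crd p (j, true) = 0 ->
  test_vec (bump p (j, true)) =
  cis ((j \in codom f)%:R * crd p (j, false)) *: test_vec p.
Proof.
move=> p0.
have [/codomP[k jE]|jf] := boolP (j \in codom f); last first.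
  rewrite mul0r cis0 scale1r; apply/rowP => a; rewrite !mxE /test_poly.
  rewrite (eq_bigr (fun k => test_factor p (f k))) // => k _; apply: test_factor_bump.
  by apply: contraNneq jf => <-; exact: codom_f.
have fE : test_factor (bump p (j, true)) j = (cis (crd p (j, false)))%:P * test_factor p j.
  rewrite /test_factor !crd_pt_of eqxx p0.
  have -> : ((j, false) == (j, true) :> dir m) = false by apply/negbTE/eqP; case.
  rewrite !add0r !addr0 subrr subr0 !mulr0 !mul0r !mul1r add0r addr0.
  by rewrite !addr0 mulr1.
have E : test_poly (bump p (j, true)) = (cis (crd p (j, false)))%:P * test_poly p.
  rewrite /test_poly (bigD1 k) //= [in RHS](bigD1 k) //= -jE fE -mulrA.
  congr (_ * (_ * _)); apply: eq_bigr => l lk; apply: test_factor_bump.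
  by rewrite jE; apply: contra lk => /eqP/f_inj ->.
by apply/rowP => a; rewrite mul1r !mxE E coefCM.
Qed.

End test_map.

Theorem section_cover_ge (R : realType) (n k : nat) :
  section_cover (@ev2 R (CP R n)) k -> (2 * n <= k)%N.
Proof.
move=> sc; rewrite leqNgt; apply/negP => kn; apply: contraPP sc => _.
rewrite mul2n -addnn in kn.
have li : injective (@lshift n n) := @lshift_inj n n.
have ri : injective (@rshift n n) := @rshift_inj n n.
(* Of the 2n factors T^2 the first n move [u] only and the last n move [v] only, so [du j - dv j] is
   1 or -1. *)
apply: (@no_small_section_cover R n (n + n) (test_vec (@lshift n n)) (test_vec (@rshift n n))
  (fun j => (j \in codom (@lshift n n))%:R) (fun j => (j \in codom (@rshift n n))%:R)) kn.
- exact: test_vec_neq0.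
- exact: test_vec_neq0.
- exact: ccont_test_vec.
- exact: ccont_test_vec.
- exact: test_vec_bumpx.
- exact: test_vec_bumpx.
- by move=> p j; exact: test_vec_bumpy.
- by move=> p j; exact: test_vec_bumpy.
move=> j; case: (split_ordP j) => i ->.
  rewrite codom_f (_ : (_ \in codom (@rshift n n)) = false) ?subr0 ?normr1 //.
  by apply/negP => /codomP[i' /eqP]; rewrite eq_lrshift.
rewrite (codom_f (@rshift n n)) (_ : (_ \in codom (@lshift n n)) = false) ?sub0r ?normrN1 //.
by apply/negP => /codomP[i' /eqP]; rewrite eq_rlshift.
Qed.

(** * Symmetric orthogonalization and sections *)

Section symmetric_orthogonalization.
Variables (R : realType) (n : nat).
Local Notation vec := 'rV[R[i]^o]_n.+1.
Local Notation conj := (@Num.conj R[i]).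

Definition node (k : nat) (v : vec) : R[i] := \sum_a v 0 a * k%:R ^+ a.

Definition vpoly (v : vec) : {poly R[i]} := \poly_(a < n.+1) (v 0 (inord a)).

Lemma node_horner k v : node k v = (vpoly v).[k%:R].
Proof. by rewrite horner_poly; apply: eq_bigr => a _; rewrite inord_val. Qed.

Lemma vpoly_eq0 v : vpoly v = 0 -> v = 0.
Proof.
move=> /polyP h; apply/rowP => a; have := h a.
by rewrite coef_poly ltn_ord inord_val coef0 mxE.
Qed.

Lemma poly_nodes_eq0 (p : {poly R[i]}) N : (size p <= N)%N ->
  (forall k, (k < N)%N -> p.[k%:R] = 0) -> p = 0.
Proof.
move=> pN p0; apply/eqP; apply: contraLR pN => pn0; rewrite -ltnNge.
rewrite -[N](size_iota 0) -(size_map (fun k : nat => k%:R : R[i])).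
apply: max_poly_roots => //.
  by apply/allP => _ /mapP[k + ->]; rewrite mem_iota /= => kN; apply/rootP; exact: p0.
rewrite map_inj_uniq ?iota_uniq // => i j /eqP.
by rewrite eqr_nat => /eqP.
Qed.

Lemma node_comb k (x y : R[i]) (u v : vec) :
  node k (x *: u + y *: v) = x * node k u + y * node k v.
Proof.
rewrite /node !mulr_sumr -big_split; apply: eq_bigr => a _ /=.
by rewrite !mxE mulrDl !mulrA.
Qed.

(** A Hermitian form built from the values at 0, ..., n; it is definite because these determine a
    polynomial of degree at most n. *)
Definition inner (u v : vec) : R[i] := \sum_(r < n.+1) conj (node r u) * node r v.

Lemma inner_conj u v : conj (inner u v) = inner v u.
Proof.
rewrite /inner rmorph_sum; apply: eq_bigr => r _.
by rewrite rmorphM /= conjCK mulrC.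
Qed.

Lemma inner_comb (x y z w : R[i]) (u v : vec) :
  inner (x *: u + y *: v) (z *: u + w *: v) =
  conj x * z * inner u u + conj x * w * inner u v +
  conj y * z * inner v u + conj y * w * inner v v.
Proof.
rewrite /inner !mulr_sumr -!big_split; apply: eq_bigr => r _ /=.
by rewrite !node_comb rmorphD !rmorphM /=; ring.
Qed.

Lemma inner_ge0 u : 0 <= inner u u.
Proof. by apply: sumr_ge0 => r _; rewrite -normCKC exprn_ge0. Qed.

Lemma inner_gt0 u : u != 0 -> 0 < inner u u.
Proof.
move=> u0; rewrite lt_def inner_ge0 andbT; apply: contra u0 => /eqP h.
apply/eqP; apply: vpoly_eq0; apply: (@poly_nodes_eq0 _ n.+1); first exact: size_poly.
move=> k kn; rewrite -node_horner.
have /psumr_eq0P/(_ h (Ordinal kn) isT) : forall r : 'I_n.+1, true -> 0 <= conj (node r u) * node r u.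
  by move=> r _; rewrite -normCKC exprn_ge0.
by rewrite -normCKC => /eqP; rewrite expf_eq0 normr_eq0 => /eqP.
Qed.

(** Positivity of the form on [inner v v *: u - inner v u *: v], divided by [inner v v]. *)
Lemma inner_CS u v : v != 0 -> 0 <= inner u u * inner v v - inner u v * conj (inner u v).
Proof.
move=> v0; have b0 := inner_gt0 v0; rewrite -(pmulr_rge0 _ b0).
have := inner_ge0 (inner v v *: u + (- conj (inner u v)) *: v).
rewrite inner_comb rmorphN /= conjCK inner_conj -[inner v u]inner_conj.
by congr (0 <= _); ring.
Qed.

(* principal square root of nonnegative numbers, defined so as to be continuous *)
Definition rsqrt (z : R[i]) : R[i] := (Num.sqrt (complex.Re z))%:C.

Lemma rsqrt_ge0 z : 0 <= rsqrt z.
Proof. by rewrite /rsqrt ler0c sqrtr_ge0. Qed.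

Lemma sqr_rsqrt z : 0 <= z -> rsqrt z ^+ 2 = z.
Proof.
move=> z0; rewrite /rsqrt -rmorphXn /= sqr_sqrtr; first exact: RRe_real (ger0_real z0).
by rewrite -ler0c RRe_real // ger0_real.
Qed.

Lemma rsqrt_gt0 z : 0 < z -> 0 < rsqrt z.
Proof.
move=> z0; have z0' := ltW z0; rewrite lt_def rsqrt_ge0 andbT; apply: contraTneq z0 => h.
by rewrite -(sqr_rsqrt z0') h expr0n ltxx.
Qed.

Lemma conj_rsqrt z : conj (rsqrt z) = rsqrt z.
Proof. by apply: CrealP; apply: ger0_real; exact: rsqrt_ge0. Qed.

Lemma rsqrtM (c z : R[i]) : 0 <= c -> 0 <= z -> rsqrt (c ^+ 2 * z) = c * rsqrt z.
Proof.
move=> c0 z0; apply/eqP; rewrite -(@eqrXn2 _ 2) ?rsqrt_ge0 ?mulr_ge0 ?rsqrt_ge0 //.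
by rewrite exprMn !sqr_rsqrt // mulr_ge0 // exprn_ge0.
Qed.

Definition len (u : vec) : R[i] := rsqrt (inner u u).
Definition gap (u v : vec) : R[i] :=
  rsqrt (inner u u * inner v v - inner u v * conj (inner u v)).

(** Up to scaling, the first vector of the symmetric (Loewdin) orthogonalization of the normalized
    pair; the second is [orth v u]. Here [gap] is the square root of the Gram determinant. *)
Definition orth (u v : vec) : vec :=
  (len v * (len u * len v + gap u v)) *: u + (- (len u * conj (inner u v))) *: v.

Lemma gapC u v : gap u v = gap v u.
Proof. by rewrite /gap !inner_conj; congr rsqrt; ring. Qed.

Lemma orth_orthogonal u v : u != 0 -> v != 0 -> inner (orth u v) (orth v u) = 0.
Proof.
move=> u0 v0.
rewrite /orth [X in inner _ X]addrC inner_comb !rmorphN !rmorphM !rmorphD !rmorphM /=.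
rewrite (gapC v u) /len /gap !conj_rsqrt -[inner v u]inner_conj !conjCK.
have A2 := sqr_rsqrt (inner_ge0 u); have B2 := sqr_rsqrt (inner_ge0 v).
have := sqr_rsqrt (inner_CS u v0).
move: A2 B2; set A := rsqrt (inner u u); set B := rsqrt (inner v v); set G := rsqrt (_ - _).
move=> A2 B2 G2; rewrite -A2 -B2 in G2 *.
move: G2; move: (inner u v) => c; move: (conj c) => d G2.
have dE : c * d = A ^+ 2 * B ^+ 2 - G ^+ 2 by rewrite G2; ring.
transitivity (A * B * c * (G ^+ 2 - A ^+ 2 * B ^+ 2 + c * d)); first by ring.
by rewrite dE; ring.
Qed.

Lemma lenZ (x : R[i]) u : len (x *: u) = `|x| * len u.
Proof.
rewrite /len -rsqrtM ?inner_ge0 ?normr_ge0 //; congr rsqrt.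
have := inner_comb x 0 x 0 u 0; rewrite !scale0r !addr0 => ->.
by rewrite !rmorph0 normCK; ring.
Qed.

Lemma innerZ (x y : R[i]) u v : inner (x *: u) (y *: v) = conj x * y * inner u v.
Proof.
have := inner_comb x 0 0 y u v; rewrite !scale0r !addr0 !add0r => ->.
by rewrite !rmorph0; ring.
Qed.

Lemma gapZ (x y : R[i]) u v : v != 0 ->
  gap (x *: u) (y *: v) = `|x| * `|y| * gap u v.
Proof.
move=> v0; rewrite /gap -rsqrtM ?mulr_ge0 ?normr_ge0 ?inner_CS //; congr rsqrt.
by rewrite !innerZ !rmorphM /= !conjCK exprMn !normCK; ring.
Qed.

Lemma orthZ (x y : R[i]) u v : v != 0 ->
  orth (x *: u) (y *: v) = (`|x| * `|y| ^+ 2 * x) *: orth u v.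
Proof.
move=> v0; rewrite /orth !lenZ gapZ // innerZ !rmorphM /= conjCK scalerDr !scalerA.
congr (_ *: _ + _ *: _); first by ring.
by rewrite normCK; ring.
Qed.

Definition sect (k : nat) (u v : vec) : R[i] := conj (node k (orth u v)) * node k (orth v u).

Lemma sectC k u v : sect k v u = conj (sect k u v).
Proof. by rewrite /sect rmorphM /= conjCK mulrC. Qed.

Lemma nodeZ k (x : R[i]) u : node k (x *: u) = x * node k u.
Proof. by have := node_comb k x 0 u 0; rewrite !scale0r !addr0 mul0r addr0. Qed.

Lemma sectZ k (x y : R[i]) u v : u != 0 -> v != 0 ->
  sect k (x *: u) (y *: v) = `|x| ^+ 3 * `|y| ^+ 3 * (conj x * y) * sect k u v.
Proof.
move=> u0 v0; rewrite /sect !orthZ // !nodeZ !rmorphM /= ?rmorphXn /= !conj_normC.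
by ring.
Qed.

(** The coefficient of [u] in [orth u v] is positive, so vanishing would make [u] a multiple of
    [v]. *)
Lemma orth_neq0 u v : u != 0 -> v != 0 -> line u <> line v -> orth u v != 0.
Proof.
move=> u0 v0 uv; apply/eqP => /eqP; rewrite addr_eq0 -scaleNr opprK => /eqP h.
have l0 : len v * (len u * len v + gap u v) != 0.
  rewrite mulf_neq0 // lt0r_neq0 ?rsqrt_gt0 ?inner_gt0 //.
  by rewrite ltr_pwDl ?rsqrt_ge0 // mulr_gt0 // rsqrt_gt0 // inner_gt0.
have uE : u = ((len v * (len u * len v + gap u v))^-1 * (len u * conj (inner u v))) *: v.
  by rewrite -scalerA -h scalerA mulVf // scale1r.
apply: uv; apply/lineP => //.
exists ((len v * (len u * len v + gap u v))^-1 * (len u * conj (inner u v))) => //.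
by apply: contra u0 => /eqP z; rewrite uE z scale0r.
Qed.

Lemma sect_cover u v : u != 0 -> v != 0 -> line u <> line v ->
  exists2 i : 'I_(2 * n), true & sect i.+1 u v != 0.
Proof.
move=> u0 v0 uv; apply: contrapT => nex.
have s0 k : (k < 2 * n)%N -> sect k.+1 u v = 0.
  move=> kn; apply/eqP; apply: contrapT => /negP h; apply: nex.
  by exists (Ordinal kn).
have vu : line v <> line u by move/esym.
have O1 := orth_neq0 u0 v0 uv; have O2 := orth_neq0 v0 u0 vu.
(* The terms of the form at the nodes 1, ..., n vanish by assumption, so orthogonality leaves the
   one at 0. *)
have s00 : sect 0 u v = 0.
  have := orth_orthogonal u0 v0; rewrite /inner big_ord_recl big1 ?addr0 // => r _.
  by apply: s0; rewrite (leq_trans (ltn_ord r)) // mul2n -addnn leq_addr.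
(* The nodes are real, so conjugating coefficients conjugates values; the numbers [sect k u v] thus
   become values of a polynomial of degree at most 2n. *)
pose w : vec := \row_a conj (orth u v 0 a).
have wE k : conj (node k (orth u v)) = node k w.
  rewrite /node rmorph_sum; apply: eq_bigr => a _.
  by rewrite [w 0 a]mxE rmorphM /= rmorphXn /= conjC_nat.
have w0 : w != 0.
  apply: contra O1 => /eqP/rowP w0; apply/eqP/rowP => a; have := w0 a.
  by rewrite !mxE => /eqP; rewrite conjC_eq0 => /eqP.
suff /eqP : vpoly w * vpoly (orth v u) = 0.
  by rewrite mulf_eq0 => /orP[/eqP/vpoly_eq0/eqP|/eqP/vpoly_eq0/eqP]; apply/negP.
apply: (@poly_nodes_eq0 _ (2 * n).+1).
  apply: leq_trans (size_polyMleq _ _) _.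
  have h1 : (size (vpoly w) <= n.+1)%N := size_poly _ _.
  have h2 : (size (vpoly (orth v u)) <= n.+1)%N := size_poly _ _.
  by move: h1 h2; move: (size (vpoly w)) (size (vpoly (orth v u))) => s1 s2; lia.
move=> k kn; rewrite hornerM -!node_horner -wE.
by case: k kn => [_|k kn]; [exact: s00|exact: s0].
Qed.

End symmetric_orthogonalization.

(** * Upper bound *)

(** The map [phi] is constant on the fibres of [q], hence descends to the range; openness of [q]
    makes the descended map continuous. *)
Lemma has_section_image (D E B : topologicalType) (p : E -> B) (q : D -> B) (phi : D -> E) :
  continuous phi -> (forall A, open A -> open (q @` A)) ->
  (forall d, p (phi d) = q d) -> (forall d d', q d = q d' -> phi d = phi d') ->
  has_section p (range q).
Proof.
move=> cphi oq pphi phiq.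
have ex (b : range q) : exists d, q d = set_val b by have [d _ qd] := set_valP b; exists d.
exists (fun b => phi (sval (cid (ex b)))); split; last first.
  by move=> b; rewrite pphi; exact: (svalP (cid (ex b))).
apply/continuousP => A oA; exists (q @` (phi @^-1` A)).
  by apply: oq; move/continuousP : cphi; exact.
apply/seteqP; split => b /=.
  move=> [d Ad qd]; rewrite (phiq _ d) // qd; exact: (svalP (cid (ex b))).
by move=> Ab; exists (sval (cid (ex b))) => //; exact: (svalP (cid (ex b))).
Qed.

Section upper_bound.
Variables (R : realType) (n : nat).
Local Notation vec := 'rV[R[i]^o]_n.+1.
Local Notation CP := (CP R n).
Local Notation path := (free_path R CP).
Local Notation interval := (@unit_interval R).
Local Notation conj := (@Num.conj R[i]).

Lemma Re_continuous : continuous (fun z : R[i]^o => complex.Re z : R).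
Proof.
move=> z; apply/(@cvgrPdist_lt _ R^o R[i]^o (nbhs z)) => e e0.
near=> w.
have : `|(z : R[i]) - w| < e%:C.
  near: w; apply: (@cvgr_dist_lt _ R[i]^o _ (nbhs z) _ id z cvg_id).
  by rewrite ltcR.
rewrite normc_def ltcR; apply: le_lt_trans.
rewrite -(raddfB (@complex.Re R : Rcomplex R -> R)) -sqrtr_sqr ler_sqrt ?lerDl ?sqr_ge0 //.
by rewrite addr_ge0 ?sqr_ge0.
Unshelve. all: by end_near. Qed.

Lemma ccont_rsqrt (T : topologicalType) (x : T) (f : T -> R[i]) :
  ccont x f -> ccont x (fun y => rsqrt (f y)).
Proof.
move=> cf; apply: ccont_real.
apply: (@continuous_comp _ _ _ (fun y => complex.Re (f y)) Num.sqrt); last exact: sqrt_continuous.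
exact: (@continuous_comp _ _ _ (f : T -> R[i]^o) (fun z : R[i]^o => complex.Re z) x cf (@Re_continuous _)).
Qed.

Lemma ccont_norm (T : topologicalType) (x : T) (f : T -> R[i]) :
  ccont x f -> ccont x (fun y => `|f y|).
Proof. by move=> cf; exact: (@cvg_norm R[i] R[i]^o). Qed.

Lemma ccontN (T : topologicalType) (x : T) (f : T -> R[i]) :
  ccont x f -> ccont x (fun y => - f y).
Proof. by move=> cf; exact: (@cvgN R[i] R[i]^o). Qed.

Section vector_functions.
Variables (T : topologicalType) (x : T).

Definition vcont (f : T -> vec) : Prop := forall a, ccont x (fun y => f y 0 a).

Lemma vcont_comb (c d : T -> R[i]) (f g : T -> vec) :
  ccont x c -> ccont x d -> vcont f -> vcont g ->
  vcont (fun y => c y *: f y + d y *: g y).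
Proof.
move=> cc cd cf cg a.
rewrite (_ : (fun y => _) = fun y => c y * f y 0 a + d y * g y 0 a); last first.
  by apply/funext => y; rewrite !mxE.
by apply: ccontD; [exact: ccontM cc (cf a)|exact: ccontM cd (cg a)].
Qed.

Variables (f g : T -> vec).
Hypotheses (cf : vcont f) (cg : vcont g).

Lemma ccont_node (h : T -> vec) k : vcont h -> ccont x (fun y => node k (h y)).
Proof. by move=> ch; apply: ccont_sum => a; apply: ccontM; [exact: ch|exact: ccont_cst]. Qed.

Lemma ccont_inner (h l : T -> vec) : vcont h -> vcont l -> ccont x (fun y => inner (h y) (l y)).
Proof.
by move=> ch cl; apply: ccont_sum => r; apply: ccontM; [apply: ccont_conj|]; exact: ccont_node.
Qed.

Lemma ccont_len (h : T -> vec) : vcont h -> ccont x (fun y => len (h y)).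
Proof. by move=> ch; apply: ccont_rsqrt; exact: ccont_inner. Qed.

Lemma vcont_orth (h l : T -> vec) : vcont h -> vcont l -> vcont (fun y => orth (h y) (l y)).
Proof.
move=> ch cl.
have ci := ccont_inner ch cl; have chl := ccont_len ch; have cll := ccont_len cl.
have cgap : ccont x (fun y => gap (h y) (l y)).
  exact: ccont_rsqrt (ccontD (ccontM (ccont_inner ch ch) (ccont_inner cl cl))
    (ccontN (ccontM ci (ccont_conj ci)))).
apply: (vcont_comb _ _ ch cl).
  exact: ccontM cll (ccontD (ccontM chl cll) cgap).
exact: ccontN (ccontM chl (ccont_conj ci)).
Qed.

Lemma ccont_sect k : ccont x (fun y => sect k (f y) (g y)).
Proof.
exact: ccontM (ccont_conj (ccont_node (k := k) (vcont_orth cf cg))) (ccont_node (k := k) (vcont_orth cg cf)).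
Qed.

End vector_functions.

(** The saturation of an open set is the union of its nonzero rescalings, which are open. *)
Lemma line_open (u : vec) (N : set vec) : u != 0 -> nbhs u N ->
  nbhs (line u) [set line w | w in N `&` [set w | w != 0]].
Proof.
move=> u0; rewrite (nbhsE u) => -[N' [oN' N'u] N'N].
pose L : set CP := [set line w | w in N' `&` [set w | w != 0]].
suff oL : open L.
  rewrite nbhsE; exists L.
    by split => //; exists u.
  by move=> _ [w [/N'N Nw w0] <-]; exists w.
rewrite /open /= /quotient_open.
exists (\bigcup_(a in [set a : R[i] | a != 0]) [set w : vec | N' (a *: w)]).
  apply: bigcup_open => a a0; apply: open_comp oN' => w _; apply: row_continuous_at => b.
  rewrite (_ : (fun y => _) = fun y : vec => a * y 0 b); last first.
    by apply/funext => y; rewrite mxE.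
  by apply: ccontM; [exact: ccont_cst|exact: ccont_coord].
apply/seteqP; split => w /=; have w0 : set_val w != 0 := set_valP w.
  have piE : line (set_val w) = \pi_CP w by rewrite /line valKd.
  move=> [a a0 Naw]; exists (a *: set_val w).
    by split => //; rewrite /= scaler_eq0 negb_or a0.
  rewrite -piE; apply/lineP => //; first by rewrite scaler_eq0 negb_or a0.
  by exists a.
have piE : line (set_val w) = \pi_CP w by rewrite /line valKd.
move=> [w' [Nw' w'0]]; rewrite -piE => /(lineP w'0 w0)[a a0 w'E].
by exists a => //; have := Nw'; rewrite w'E.
Qed.

Lemma lines_indep (u v : vec) (x y : R[i]) : u != 0 -> v != 0 -> line u <> line v ->
  x *: u + y *: v = 0 -> x = 0 /\ y = 0.
Proof.
move=> u0 v0 uv h; have x0 : x = 0.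
  apply/eqP; apply: contrapT => /negP x0; apply: uv; apply/lineP => //.
  have uE : u = (- (x^-1 * y)) *: v.
    apply: (scalerI x0); rewrite scalerA mulrN mulrA mulfV // mul1r scaleNr.
    by apply/eqP; rewrite -addr_eq0 h.
  exists (- (x^-1 * y)) => //; apply: contra u0 => /eqP z.
  by rewrite uE z scale0r.
split=> //; move: h; rewrite x0 scale0r add0r => /eqP.
by rewrite scaler_eq0 (negbTE v0) orbF => /eqP.
Qed.

(** * The symmetric motion planner given by the k-th node *)

Variable k : nat.

Definition good_pair : set (vec * vec) :=
  [set w | [/\ w.1 != 0, w.2 != 0, line w.1 <> line w.2 & sect k w.1 w.2 != 0]].

(** Interpolation from [w.1], rotated by the phase of [sect], to [w.2]; the lengths and the modulus
    are there to make both terms scale alike. *)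
Definition path_vec (w : vec * vec) (t : R) : vec :=
  ((1 - t)%:C * len w.2 * sect k w.1 w.2) *: w.1 + (t%:C * len w.1 * `|sect k w.1 w.2|) *: w.2.

Lemma len_neq0 (u : vec) : u != 0 -> len u != 0.
Proof. by move=> u0; rewrite lt0r_neq0 // rsqrt_gt0 // inner_gt0. Qed.

Lemma path_vec_neq0 w t : good_pair w -> path_vec w t != 0.
Proof.
move=> [u0 v0 uv s0]; apply/eqP => /(lines_indep u0 v0 uv)[/eqP].
rewrite mulf_eq0 (negbTE s0) orbF mulf_eq0 (negbTE (len_neq0 v0)) orbF => /eqP/complexI/eqP.
rewrite subr_eq0 => /eqP <- /eqP; rewrite mulf_eq0 normr_eq0 (negbTE s0) orbF.
by rewrite mulf_eq0 (negbTE (len_neq0 u0)) orbF oner_eq0.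
Qed.

(** The path of lines therefore depends only on the two lines, not on the vectors spanning them. *)
Lemma path_vecZ (x y : R[i]) (u v : vec) t : u != 0 -> v != 0 ->
  path_vec (x *: u, y *: v) t = (`|x| ^+ 5 * `|y| ^+ 4 * y) *: path_vec (u, v) t.
Proof.
move=> u0 v0; rewrite /path_vec /= !lenZ sectZ // scalerDr !scalerA.
congr (_ *: _ + _ *: _).
  have -> : `|x| ^+ 5 = `|x| ^+ 3 * (x * conj x) by rewrite -normCK; ring.
  by ring.
by move: (sect k u v) => S; rewrite !normrM ?normrX !normr_id norm_conjC; ring.
Qed.

(** Swapping conjugates [sect], and a number times its conjugate is its squared modulus: up to a
    scalar, time is reversed. *)
Lemma path_vec_swap (u v : vec) t :
  sect k u v *: path_vec (v, u) t = `|sect k u v| *: path_vec (u, v) (1 - t).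
Proof.
rewrite /path_vec /= (sectC k u v) norm_conjC opprB addrCA subrr addr0.
rewrite !scalerDr !scalerA addrC; congr (_ *: _ + _ *: _); first by ring.
transitivity ((1 - t)%:C * len u * (sect k u v * conj (sect k u v))); first by ring.
by rewrite -normCK; ring.
Qed.

Lemma line_scale (u : vec) (x : R[i]) : x != 0 -> u != 0 -> line (x *: u) = line u.
Proof.
by move=> x0 u0; apply/lineP => //; [rewrite scaler_eq0 negb_or x0|exists x].
Qed.

Lemma pair_vcont (T : topologicalType) (x : T) (f : T -> vec * vec) : continuous_at x f ->
  vcont x (fun y => (f y).1) /\ vcont x (fun y => (f y).2).
Proof.
move=> cf; split => a.
  apply: (@ccont_comp R _ _ x (fun y => (f y).1) (fun w : vec => w 0 a)); last exact: ccont_coord.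
  by apply: (@continuous_comp _ _ _ f fst); last exact: cvg_fst.
apply: (@ccont_comp R _ _ x (fun y => (f y).2) (fun w : vec => w 0 a)); last exact: ccont_coord.
by apply: (@continuous_comp _ _ _ f snd); last exact: cvg_snd.
Qed.

Lemma good_open : open good_pair.
Proof.
rewrite openE => w [u0 v0 uv s0].
have [cu cv] := @pair_vcont _ w id cvg_id.
have [A [B [oA oB Au Bv AB]]] := CP_separated uv.
have nA : \forall z \near w, A (line z.1).
  have := @continuous_comp _ _ _ fst (@line R n) w cvg_fst (line_continuous_at u0).
  by apply; exact: open_nbhs_nbhs.
have nB : \forall z \near w, B (line z.2).
  have := @continuous_comp _ _ _ snd (@line R n) w cvg_snd (line_continuous_at v0).
  by apply; exact: open_nbhs_nbhs.
have nu : \forall z \near w, z.1 != 0.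
  by exists ([set z : vec | z != 0], setT); [split; [exact: vec_near_neq0|exact: filterT]|move=> z []].
have nv : \forall z \near w, z.2 != 0.
  by exists (setT, [set z : vec | z != 0]); [split; [exact: filterT|exact: vec_near_neq0]|move=> z []].
have ns : \forall z \near w, sect k z.1 z.2 != 0.
  exact: (@ccont_near_neq0 R _ w (fun z : vec * vec => sect k z.1 z.2) s0 (@ccont_sect _ _ _ _ cu cv k)).
near=> z; split; [by near: z|by near: z| |by near: z].
move=> zz; have : (A `&` B) (line z.1).
  by split; [near: z|rewrite zz; near: z].
by rewrite AB.
Unshelve. all: by end_near. Qed.

(** Taken jointly in the pair and the time, so that currying yields continuity into the compact-open
    topology. *)
Definition path_map (z : good_pair * interval) : CP := line (path_vec (set_val z.1) (set_val z.2)).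

Lemma path_map_continuous : continuous path_map.
Proof.
move=> z.
have c1 : continuous_at z (fun y : good_pair * interval => set_val y.1).
  by apply: (@continuous_comp _ _ _ fst set_val); [exact: cvg_fst|exact: initial_continuous].
have c2 : continuous_at z (fun y : good_pair * interval => set_val y.2).
  by apply: (@continuous_comp _ _ _ snd set_val); [exact: cvg_snd|exact: initial_continuous].
have [cu cv] := pair_vcont c1.
have cs := @ccont_sect _ _ _ _ cu cv k.
apply: (@continuous_comp _ _ _ (fun y : good_pair * interval => path_vec (set_val y.1) (set_val y.2)) (@line R n)).
  apply: row_continuous_at; apply: (vcont_comb _ _ cu cv).
    apply: (ccontM _ cs); apply: (ccontM _ (ccont_len cv)); apply: ccont_real.
    by apply: cvgB; [exact: cvg_cst|exact: c2].
  exact: ccontM (ccontM (ccont_real c2) (ccont_len cu)) (ccont_norm cs).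
apply: line_continuous_at; apply: path_vec_neq0; exact: (set_valP z.1).
Qed.

Definition plan_path (w : good_pair) : path :=
  HB.pack_for (continuousType interval CP) (curry path_map w)
    (isContinuous.Build interval CP (curry path_map w)
       ((continuous_curry path_map_continuous).2 w)).

Lemma ev_plan_path (w : good_pair) :
  ev (plan_path w) = (line (set_val w).1, line (set_val w).2).
Proof.
have [u0 v0 _ s0] := set_valP w.
congr (_, _); rewrite -[LHS]/(line (path_vec (set_val w) _)) /path_vec /=.
  rewrite subr0 mul0r mul0r scale0r addr0 mul1r line_scale //.
  by rewrite mulf_neq0 // len_neq0.
rewrite subrr !mul0r scale0r add0r mul1r line_scale //.
by rewrite mulf_neq0 ?len_neq0 // normr_eq0.
Qed.

Lemma plan_nonloop_subproof (w : good_pair) : plan_path w \in @nonloop R CP.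
Proof.
apply/mem_set; rewrite /nonloop /= ev_plan_path.
by have [_ _ uv _] := set_valP w.
Qed.

Definition plan_nonloop (w : good_pair) : @nonloop R CP :=
  exist (fun g => g \in @nonloop R CP) _ (plan_nonloop_subproof w).

Definition plan (w : good_pair) : unordered_paths R CP :=
  orbit_of (@reverse_nonloopK R CP) (plan_nonloop w).

Lemma endpoints_subproof (w : good_pair) :
  (line (set_val w).1, line (set_val w).2) \in off_diagonal CP.
Proof. by apply/mem_set; have [_ _ uv _] := set_valP w. Qed.

Definition endpoints (w : good_pair) : off_diagonal CP :=
  exist (fun x => x \in off_diagonal CP) _ (endpoints_subproof w).

Definition unordered_ends (w : good_pair) : unordered_pairs CP :=
  orbit_of (@switchK CP) (endpoints w).

Lemma ev2_plan w : ev2 (plan w) = unordered_ends w.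
Proof.
rewrite ev2E; congr orbit_of; apply/val_inj.
exact: ev_plan_path.
Qed.

Lemma plan_continuous : continuous plan.
Proof.
have c1 : continuous plan_nonloop.
  apply/continuousP => A [B [B' oB' <-] <-].
  have cc : continuous (curry path_map : good_pair -> {compact-open, interval -> CP}).
    exact: continuous_curry_fun path_map_continuous.
  exact: ((continuousP _).1 cc _ oB').
move=> w; apply: (@continuous_comp _ _ _ plan_nonloop); first exact: c1.
exact: pi_continuous.
Qed.

Lemma plan_path_same (w w' : good_pair) :
  line (set_val w).1 = line (set_val w').1 -> line (set_val w).2 = line (set_val w').2 ->
  plan_path w = plan_path w'.
Proof.
have [u0 v0 _ _] := set_valP w; have [u'0 v'0 _ _] := set_valP w'.
move=> /(lineP u0 u'0)[x x0 uE] /(lineP v0 v'0)[y y0 vE].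
apply/continuousEP => t.
rewrite -[LHS]/(line (path_vec (set_val w) _)) -[RHS]/(line (path_vec (set_val w') _)).
rewrite (surjective_pairing (set_val w)) uE vE path_vecZ // line_scale //.
  by rewrite !mulf_neq0 ?expf_neq0 ?normr_eq0.
by rewrite -surjective_pairing; exact: path_vec_neq0 (set_valP w').
Qed.

Lemma plan_path_swap (w w' : good_pair) :
  line (set_val w).1 = line (set_val w').2 -> line (set_val w).2 = line (set_val w').1 ->
  plan_path w = reverse_path (plan_path w').
Proof.
have [u0 v0 _ _] := set_valP w; have [u'0 v'0 _ s'0] := set_valP w'.
move=> /(lineP u0 v'0)[x x0 uE] /(lineP v0 u'0)[y y0 vE].
apply/continuousEP => t.
rewrite -[LHS]/(line (path_vec (set_val w) _)).
rewrite -[RHS]/(line (path_vec (set_val w') (1 - set_val t))).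
rewrite (surjective_pairing (set_val w)) uE vE path_vecZ //.
have p0 : path_vec (set_val w') (1 - set_val t) != 0 := path_vec_neq0 _ (set_valP w').
have n0 : `|sect k (set_val w').1 (set_val w').2| != 0 by rewrite normr_eq0.
have -> : path_vec ((set_val w').2, (set_val w').1) (set_val t) =
    ((sect k (set_val w').1 (set_val w').2)^-1 * `|sect k (set_val w').1 (set_val w').2|) *:
      path_vec (set_val w') (1 - set_val t).
  rewrite {5}(surjective_pairing (set_val w')) -scalerA -path_vec_swap scalerA mulVf // scale1r.
  by [].
rewrite scalerA line_scale //.
by rewrite !mulf_neq0 ?expf_neq0 ?normr_eq0 ?invr_eq0.
Qed.

(** Equal lines give the same path and swapped lines the reversed one, the same point of the orbit
    space. *)
Lemma plan_unordered_ends w w' : unordered_ends w = unordered_ends w' -> plan w = plan w'.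
Proof.
move=> /(@orbit_ofP _ _ (@switchK CP))[e|e].
  have [e1 e2] : line (set_val w).1 = line (set_val w').1 /\
      line (set_val w).2 = line (set_val w').2.
    by have := congr1 set_val e => -[].
  by congr orbit_of; apply/val_inj; exact: plan_path_same.
have [e1 e2] : line (set_val w).1 = line (set_val w').2 /\
    line (set_val w).2 = line (set_val w').1.
  by have := congr1 set_val e => -[].
apply/(@orbit_ofP _ _ (@reverse_nonloopK R CP)); right; apply/val_inj.
exact: plan_path_swap.
Qed.

Lemma lines_open (A : set (vec * vec)) : open A -> A `<=` good_pair ->
  open [set (line w.1, line w.2) | w in A].
Proof.
move=> oA Ag; rewrite openE => _ [w Aw <-].
have [u0 v0 _ _] := Ag _ Aw.
have [[N1 N2] /= [wN1 wN2] NA] : nbhs w A by exact: open_nbhs_nbhs.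
exists ([set line u | u in N1 `&` [set u | u != 0]], [set line u | u in N2 `&` [set u | u != 0]]).
  by split; apply: line_open.
move=> [x y] /= [[u [N1u _] <-] [v [N2v _] <-]].
by exists (u, v) => //; exact: NA.
Qed.

(** Pulled back to ordered pairs, the image consists of the pairs of lines coming from [A] and their
    mirror images. *)
Lemma unordered_ends_open (A : set good_pair) : open A -> open (unordered_ends @` A).
Proof.
move=> [A' oA' A'E].
pose L : set (CP * CP) := [set (line w.1, line w.2) | w in A' `&` good_pair].
have oL : open L by apply: lines_open => [|w []//]; apply: openI => //; exact: good_open.
have oL' : open [set z : CP * CP | L (z.2, z.1)].
  apply: (@open_comp _ _ (fun z : CP * CP => (z.2, z.1))) oL => z _.
  have c1 : continuous_at z (fun z : CP * CP => z.2) by exact: cvg_snd.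
  have c2 : continuous_at z (fun z : CP * CP => z.1) by exact: cvg_fst.
  exact: cvg_pair c1 c2.
change (open (orbit_of (@switchK CP) @^-1` (unordered_ends @` A))).
exists (L `|` [set z : CP * CP | L (z.2, z.1)]); first exact: openU.
have LA w : A w -> L (set_val (endpoints w)).
  move=> Aw; exists (set_val w) => //; split; last exact: (set_valP w).
  by have : (set_val @^-1` A') w by rewrite A'E.
have AL z : L z -> exists2 w, A w & set_val (endpoints w) = z.
  move=> [w [A'w gw] <-]; pose w' : good_pair := exist (fun w => w \in good_pair) w (mem_set gw).
  by exists w' => //; rewrite -A'E.
apply/seteqP; split => z.
  move=> [/AL[w Aw wz]|/AL[w Aw wz]]; refine (ex_intro2 _ _ w Aw _).
    by apply: (orbit_ofP (@switchK CP) _ _).2; left; exact: val_inj.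
  by apply: (orbit_ofP (@switchK CP) _ _).2; right; exact: val_inj.
move=> [w Aw wz]; have [wE|wE] := (orbit_ofP (@switchK CP) _ _).1 wz.
  by left; have := LA _ Aw; rewrite wE.
by right; have := LA _ Aw; rewrite wE.
Qed.

Lemma has_section_good : open (range unordered_ends) /\ has_section (@ev2 R CP) (range unordered_ends).
Proof.
split; first exact: (unordered_ends_open openT).
apply: has_section_image plan_continuous unordered_ends_open ev2_plan plan_unordered_ends.
Qed.

End upper_bound.

Theorem section_cover_double (R : realType) (n : nat) :
  section_cover (@ev2 R (CP R n)) (2 * n).
Proof.
(* The shift of the index selects the nodes 1, ..., 2n, as in [sect_cover]. *)
exists (fun i => range (@unordered_ends R n i.+1)); split.
- by move=> i; have [] := has_section_good R n i.+1.
- apply/seteqP; split => // q _.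
  pose z := orbit_repr q; have qz : orbit_of (@switchK _) z = q by exact: orbit_reprK.
  pose u := rep (set_val z).1; pose v := rep (set_val z).2.
  have u0 : u != 0 := rep_neq0 _; have v0 : v != 0 := rep_neq0 _.
  have uv : line u <> line v by rewrite !repK; exact: (set_valP z).
  have [i _ si] := sect_cover u0 v0 uv.
  exists i => //.
  have g : (u, v) \in @good_pair R n i.+1 by apply/mem_set.
  exists (exist (fun w => w \in @good_pair R n i.+1) _ g) => //.
  rewrite -qz; congr orbit_of; apply/val_inj.
  by rewrite /= !repK -surjective_pairing.
- by move=> i; have [] := has_section_good R n i.+1.
Qed.

Theorem theorem6p1 (R : realType) (n : nat) (n_ge1 : (1 <= n)%N) :
  TCS R (CP R n) = Some (2 * n + 1)%N.
Proof.
rewrite /TCS /genus; case: pselect => [h|[]]; last first.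
  by exists (2 * n)%N; apply/asboolP; exact: section_cover_double.
case: ex_minnP => k /asboolP/section_cover_ge nk min_k /=.
have kn : (k <= 2 * n)%N by apply: min_k; apply/asboolP; exact: section_cover_double.
by congr Some; rewrite addn1; congr _.+1; apply/eqP; rewrite eqn_leq kn nk.
Qed.
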